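(* Let $G$ be an $X$-generated group with Cayley graph $\Gamma_X$. Then: (1) the category $\mathcal E(X,G)$ of $X$-generated $E$-unitary inverse monoids with greatest group image $G$ is equivalent to the category $\mathcal C(X,G)$ of $G$-invariant finitary closure operators on $(\operatorname{CSub}\Gamma_X,\subseteq)$; (2) the category $\mathcal F(X,G)$ of $X$-generated $F$-inverse monoids with greatest group image $G$ is equivalent to the category $\mathcal S(X,G)$ of $G$-invariant finitary closure operators on $(\operatorname{Sub}\Gamma_X,\subseteq)$. Explicitly, the equivalences are given by $S\mapsto ()^{c_S}$ and $()^c\mapsto S_c$.
   Context: $X$-generated means generated by the image of a map $\iota:X\to S$ (in signature $(\cdot,1,{}^{-1})$ for inverse monoids, $(\cdot,1,{}^{-1},{}^{\mathfrak m})$ for $F$-inverse monoids, where $s^{\mathfrak m}$ is the greatest element of the $\sigma$-class of $s$); a morphism is canonical if it commutes with the generating maps. $\mathcal E(X,G)$ has as objects $X$-generated $E$-unitary inverse monoids $S$ whose greatest group image $S/\sigma$, $X$-generated via $\sigma^\sharp\circ\iota$, is canonically isomorphic to $G$, considered up to canonical isomorphism, with canonical inverse monoid morphisms as morphisms; $\mathcal F(X,G)$ is defined analogously for $F$-inverse monoids with canonical $F$-inverse monoid morphisms. $\Gamma_X$ is the Cayley graph of $G$ (vertices $G$, edge labeled $x$ from $g$ to $gx_G$, $x\in X\cup X^{-1}$, with inverse edges); $\operatorname{Sub}\Gamma_X$, $\operatorname{CSub}\Gamma_X$ are the posets of all, resp. connected, subgraphs (closed under endpoints and inverse edges). A closure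 operator is $G$-invariant if $(g\Delta)^c=g\Delta^c$ and finitary if $\Delta^c=\bigcup\{F^c:F\subseteq\Delta$ finite (connected in the $\operatorname{CSub}$ case)$\}$. In $\mathcal C(X,G)$ and $\mathcal S(X,G)$ there is a (unique) morphism $()^c\to()^{c'}$ iff $\Delta^c\subseteq\Delta^{c'}$ for all $\Delta$. $c_S$ is the closure operator whose closed graphs are those $\Delta$ such that for all words (resp. terms $u_0v_1^{\mathfrak m}u_1\cdots v_n^{\mathfrak m}u_n$) $u,v$ with $u_S=v_S$ and all $g,h\in V(\Delta)$, $u$ labels a path (resp. journey) in $\Delta$ from $g$ to $h$ iff $v$ does; here the journey labeled by such a term from $g$ is the sequence of paths $(g\overline{u_0},g(u_0v_1)_G\overline{u_1},\dots)$ and lies in $\Delta$ if all its paths do. $S_c$ is the monoid of pairs $(\Delta,g)$, $g\in G$, $\Delta=F^c$ for some finite (connected) $F$, $1,g\in V(\Delta)$, with $(\Delta,g)(\Xi,h)=((\Delta\cup g\Xi)^c,gh)$, $(\Delta,g)^{-1}=(g^{-1}\Delta,g^{-1})$, $(\Delta,g)^{\mathfrak m}=(\{1,g\}^c,g)$, generated via $x\mapsto(\langle\overline x\rangle^c,x_G)$.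
   Formalization: Sub Γ_X and CSub Γ_X are taken to consist of nonempty (connected) subgraphs only; with the empty graph included the claim fails, e.g. for Δ ↦ Δ ∪ V(Γ_X), since the empty graph is always c_S-closed. *)

(* Defs.v *)
From Stdlib Require Import List.

Record group := Group {
  gcar :> Type;
  gmul : gcar -> gcar -> gcar;
  gone : gcar;
  ginv : gcar -> gcar;
  gmulA : forall a b c, gmul a (gmul b c) = gmul (gmul a b) c;
  gmul1l : forall a, gmul gone a = a;
  gmul1r : forall a, gmul a gone = a;
  gmulVl : forall a, gmul (ginv a) a = gone;
  gmulVr : forall a, gmul a (ginv a) = gone }.


Definition group_generated (X : Type) (G : group) (iG : X -> G) : Prop :=
  forall P : G -> Prop,
    (forall x, P (iG x)) -> P (gone G) ->
    (forall a b, P a -> P b -> P (gmul G a b)) ->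
    (forall a, P a -> P (ginv G a)) ->
    forall a, P a.

(* Algebras of signature (.,1,^-1): a carrier type together with a     *)
(* domain predicate (the actual underlying set) and operations.        *)
Record imdata := IMData {
  icar : Type;
  idom : icar -> Prop;
  imul : icar -> icar -> icar;
  ione : icar;
  iinv : icar -> icar }.

Section InverseMonoids.
Variable S : imdata.
Local Notation D := (idom S).
Local Notation "a * b" := (imul S a b).
Local Notation "a ^-1" := (iinv S a) (at level 3, format "a ^-1").

Definition is_inverse_monoid : Prop :=
  D (ione S) /\
  (forall a b, D a -> D b -> D (a * b)) /\
  (forall a, D a -> D (a^-1)) /\
  (forall a b c, D a -> D b -> D c -> a * (b * c) = (a * b) * c) /\
  (forall a, D a -> ione S * a = a /\ a * ione S = a) /\
  (forall a, D a -> (a^-1)^-1 = a) /\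
  (forall a b, D a -> D b -> (a * b)^-1 = b^-1 * a^-1) /\
  (forall a, D a -> a * a^-1 * a = a) /\
  (forall a b, D a -> D b -> a * a^-1 * (b * b^-1) = b * b^-1 * (a * a^-1)).

Definition idem (e : icar S) : Prop := D e /\ e * e = e.

Definition nat_le (s t : icar S) : Prop := exists e, idem e /\ s = e * t.

Definition sigma_rel (s t : icar S) : Prop := exists e, idem e /\ e * s = e * t.

Definition E_unitary : Prop :=
  forall e s, idem e -> D s -> nat_le e s -> idem s.

(* m s is the greatest element of the sigma-class of s; an inverse monoid
   with such an operation is exactly an F-inverse monoid (in signature
   (.,1,^-1,^m)). *)
Definition is_max_op (m : icar S -> icar S) : Prop :=
  forall s, D s -> D (m s) /\ sigma_rel (m s) s /\
    forall t, D t -> sigma_rel t s -> nat_le t (m s).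

Variable X : Type.

Definition generated_im (i : X -> icar S) : Prop :=
  (forall x, D (i x)) /\
  forall P : icar S -> Prop,
    (forall x, P (i x)) -> P (ione S) ->
    (forall a b, P a -> P b -> P (a * b)) ->
    (forall a, P a -> P (a^-1)) ->
    forall s, D s -> P s.

Definition generated_fim (m : icar S -> icar S) (i : X -> icar S) : Prop :=
  (forall x, D (i x)) /\
  forall P : icar S -> Prop,
    (forall x, P (i x)) -> P (ione S) ->
    (forall a b, P a -> P b -> P (a * b)) ->
    (forall a, P a -> P (a^-1)) ->
    (forall a, P a -> P (m a)) ->
    forall s, D s -> P s.

(* S/sigma, X-generated via sigma^# o i, is canonically isomorphic to
   (G, iG): there is a homomorphism phi : S -> G with kernel sigma which
   commutes with the generating maps (phi then induces the canonical
   isomorphism S/sigma -> G). *)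
Definition greatest_group_image (i : X -> icar S) (G : group) (iG : X -> G)
  : Prop :=
  exists phi : icar S -> G,
    (forall a b, D a -> D b -> phi (a * b) = gmul G (phi a) (phi b)) /\
    phi (ione S) = gone G /\
    (forall a, D a -> phi (a^-1) = ginv G (phi a)) /\
    (forall x, phi (i x) = iG x) /\
    (forall s t, D s -> D t -> (phi s = phi t <-> sigma_rel s t)).

End InverseMonoids.

Definition E_object (X : Type) (G : group) (iG : X -> G)
  (S : imdata) (i : X -> icar S) : Prop :=
  is_inverse_monoid S /\ E_unitary S /\ generated_im S X i /\
  greatest_group_image S X i G iG.

Definition F_object (X : Type) (G : group) (iG : X -> G)
  (S : imdata) (m : icar S -> icar S) (i : X -> icar S) : Prop :=
  is_inverse_monoid S /\ is_max_op S m /\ generated_fim S X m i /\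
  greatest_group_image S X i G iG.

Definition canon_im_morph (X : Type) (S : imdata) (iS : X -> icar S)
  (T : imdata) (iT : X -> icar T) (f : icar S -> icar T) : Prop :=
  (forall s, idom S s -> idom T (f s)) /\
  (forall a b, idom S a -> idom S b -> f (imul S a b) = imul T (f a) (f b)) /\
  f (ione S) = ione T /\
  (forall a, idom S a -> f (iinv S a) = iinv T (f a)) /\
  (forall x, f (iS x) = iT x).

Definition canon_fim_morph (X : Type) (S : imdata) (mS : icar S -> icar S)
  (iS : X -> icar S) (T : imdata) (mT : icar T -> icar T) (iT : X -> icar T)
  (f : icar S -> icar T) : Prop :=
  canon_im_morph X S iS T iT f /\ (forall a, idom S a -> f (mS a) = mT (f a)).

Definition bijective_on (S T : imdata) (f : icar S -> icar T) : Prop :=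
  (forall s s', idom S s -> idom S s' -> f s = f s' -> s = s') /\
  (forall t, idom T t -> exists s, idom S s /\ f s = t).

Section Cayley.
Variables (X : Type) (G : group) (iG : X -> G).

Definition letter := (X + X)%type.
Definition lab (a : letter) : G :=
  match a with inl x => iG x | inr x => ginv G (iG x) end.

Definition edge := (gcar G * letter)%type.
Definition esrc (e : edge) : G := fst e.
Definition etgt (e : edge) : G := gmul G (fst e) (lab (snd e)).
Definition einv (e : edge) : edge :=
  match snd e with
  | inl x => (etgt e, inr x)
  | inr x => (etgt e, inl x)
  end.

Definition graph := ((gcar G -> Prop) * (edge -> Prop))%type.
Definition gV (D : graph) := fst D.
Definition gE (D : graph) := snd D.

Definition is_subgraph (D : graph) : Prop :=
  forall e, gE D e -> gV D (esrc e) /\ gV D (etgt e) /\ gE D (einv e).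

Definition subg (D D' : graph) : Prop :=
  (forall v, gV D v -> gV D' v) /\ (forall e, gE D e -> gE D' e).
Definition sameg (D D' : graph) : Prop := subg D D' /\ subg D' D.

Definition nonempty (D : graph) : Prop := exists v, gV D v.

Fixpoint lpath (D : graph) (g : G) (w : list letter) (h : G) : Prop :=
  match w with
  | nil => gV D g /\ g = h
  | a :: w' => gE D (g, a) /\ lpath D (gmul G g (lab a)) w' h
  end.

Definition connected (D : graph) : Prop :=
  forall g h, gV D g -> gV D h -> exists w, lpath D g w h.

Definition finite_graph (D : graph) : Prop :=
  exists (lv : list (gcar G)) (le : list edge),
    (forall v, gV D v -> In v lv) /\ (forall e, gE D e -> In e le).

Definition PSub (D : graph) : Prop := is_subgraph D /\ nonempty D.
Definition PCSub (D : graph) : Prop := PSub D /\ connected D.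

Definition translate (g : G) (D : graph) : graph :=
  (fun v => gV D (gmul G (ginv G g) v),
   fun e => gE D (gmul G (ginv G g) (fst e), snd e)).

Definition gunion (D D' : graph) : graph :=
  (fun v => gV D v \/ gV D' v, fun e => gE D e \/ gE D' e).

Section Closure.
Variable P : graph -> Prop.
Variable c : graph -> graph.

Definition is_closure_op : Prop :=
  (forall D, P D -> P (c D)) /\
  (forall D, P D -> subg D (c D)) /\
  (forall D D', P D -> P D' -> subg D D' -> subg (c D) (c D')) /\
  (forall D, P D -> sameg (c (c D)) (c D)).

Definition G_invariant : Prop :=
  forall g D, P D -> sameg (c (translate g D)) (translate g (c D)).

Definition finitary : Prop :=
  forall D, P D ->
    (forall v, gV (c D) v <->
       exists F, P F /\ finite_graph F /\ subg F D /\ gV (c F) v) /\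
    (forall e, gE (c D) e <->
       exists F, P F /\ finite_graph F /\ subg F D /\ gE (c F) e).

Definition GF_closure : Prop := is_closure_op /\ G_invariant /\ finitary.

Definition represents (closed : graph -> Prop) : Prop :=
  forall D, P D ->
    P (c D) /\ closed (c D) /\ subg D (c D) /\
    (forall D', P D' -> closed D' -> subg D D' -> subg (c D) D').

Definition single (g : G) : graph := (fun v => v = g, fun _ => False).
Definition pair_graph (g h : G) : graph :=
  (fun v => v = g \/ v = h, fun _ => False).
Definition xbar (x : X) : graph :=
  (fun v => v = gone G \/ v = iG x,
   fun e => e = (gone G, inl x) \/ e = einv (gone G, inl x)).

Definition Sc_dom (p : graph * G) : Prop :=
  (exists F, P F /\ finite_graph F /\ fst p = c F) /\
  gV (fst p) (gone G) /\ gV (fst p) (snd p).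

Definition Sc : imdata :=
  {| icar := (graph * gcar G)%type;
     idom := Sc_dom;
     imul := fun p q => (c (gunion (fst p) (translate (snd p) (fst q))),
                         gmul G (snd p) (snd q));
     ione := (c (single (gone G)), gone G);
     iinv := fun p => (translate (ginv G (snd p)) (fst p), ginv G (snd p)) |}.

Definition Sc_gen (x : X) : icar Sc := (c (xbar x), iG x).
Definition Sc_m (p : icar Sc) : icar Sc :=
  (c (pair_graph (gone G) (snd p)), snd p).
End Closure.

Section Words.
Variables (S : imdata) (i : X -> icar S).

Definition letS (a : letter) : icar S :=
  match a with inl x => i x | inr x => iinv S (i x) end.
Definition evalS (w : list letter) : icar S :=
  fold_right (fun a s => imul S (letS a) s) (ione S) w.
Definition evalG (w : list letter) : G :=
  fold_right (fun a g => gmul G (lab a) g) (gone G) w.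

Definition closed_E (D : graph) : Prop :=
  forall u v, evalS u = evalS v ->
    forall g h, gV D g -> gV D h -> (lpath D g u h <-> lpath D g v h).

(* terms u0 v1^m u1 ... vn^m un, encoded as (u0, [(v1,u1);...;(vn,un)]) *)
Definition term := (list letter * list (list letter * list letter))%type.
Variable m : icar S -> icar S.
Definition evalT (t : term) : icar S :=
  imul S (evalS (fst t))
    (fold_right (fun p s => imul S (imul S (m (evalS (fst p))) (evalS (snd p))) s)
       (ione S) (snd t)).

Fixpoint jrest (D : graph) (g : G) (r : list (list letter * list letter))
  (h : G) : Prop :=
  match r with
  | nil => g = h
  | (v, u) :: r' =>
      exists g', lpath D (gmul G g (evalG v)) u g' /\ jrest D g' r' h
  end.

Definition journey (D : graph) (g : G) (t : term) (h : G) : Prop :=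
  exists g1, lpath D g (fst t) g1 /\ jrest D g1 (snd t) h.

Definition closed_F (D : graph) : Prop :=
  forall t t', evalT t = evalT t' ->
    forall g h, gV D g -> gV D h -> (journey D g t h <-> journey D g t' h).
End Words.
End Cayley.

(* Main.v *)
(** Both equivalences are instances of one statement. Let [A] be the alphabet of
    letters together with a set [J] of jumps: [J] is empty for E-unitary monoids,
    and for F-inverse monoids a jump is a word [v], standing for the factor [v^m]
    of a term. Words over [A] then label paths (resp. journeys), and an object of
    the category amounts to a congruence on the free monoid with involution over
    [A].

    Given such a congruence and an idempotent [w w^-1], the words [u] with
    [w w^-1 <= u u^-1] label the paths from 1 of a closed graph, because in an
    E-unitary monoid [e u] is determined by [e <= u u^-1] and the image of [u] in
    [G]. The translates of these graphs, for [w] labelling a path in [D], form a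
    directed family, whose union is the least closed graph containing [D]; this
    gives [c_S].

    If [c_S <= c_T] and [u], [v] are equal in [S], then [v] labels a path in
    [c_T <u>], so [u u^-1 <= v v^-1] in [T], and by symmetry [u], [v] are equal in
    [T]. So morphisms correspond to inclusions of closure operators. Conversely
    the closure operator of [S_c] is [c]; hence the monoid of [c_S] and [S] have
    the same closure operator, and are isomorphic. *)

From Stdlib Require Import List Setoid Morphisms.
From Stdlib Require Import Classical FunctionalExtensionality PropExtensionality.
From Stdlib Require Import ClassicalEpsilon.
Require Import Defs.
Import ListNotations.

(** * Cancellation in groups and extensional equality of graphs *)

Section GroupLemmas.
Variable G : group.
Implicit Types a b : G.

Lemma gmul_invK a b : gmul G (ginv G a) (gmul G a b) = b.
Proof. rewrite gmulA, gmulVl. apply gmul1l. Qed.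

Lemma gmul_Kinv a b : gmul G a (gmul G (ginv G a) b) = b.
Proof. rewrite gmulA, gmulVr. apply gmul1l. Qed.

Lemma gmul_injl a b c : gmul G a b = gmul G a c -> b = c.
Proof. intro H. rewrite <- (gmul_invK a b), H. apply gmul_invK. Qed.

Lemma ginv_unique a b : gmul G a b = gone G -> b = ginv G a.
Proof. intro H. apply (gmul_injl a). rewrite H, gmulVr. reflexivity. Qed.

Lemma ginvK a : ginv G (ginv G a) = a.
Proof. symmetry. apply ginv_unique, gmulVl. Qed.

Lemma ginvM a b : ginv G (gmul G a b) = gmul G (ginv G b) (ginv G a).
Proof.
  symmetry. apply ginv_unique.
  rewrite <- gmulA, gmul_Kinv. apply gmulVr.
Qed.

Lemma ginv1 : ginv G (gone G) = gone G.
Proof. symmetry. apply ginv_unique, gmul1l. Qed.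

End GroupLemmas.

Ltac gnorm := autorewrite with grp; try reflexivity.
#[export] Hint Rewrite <- gmulA : grp.
#[export] Hint Rewrite ginvM ginvK ginv1 gmul1l gmul1r gmulVl gmulVr gmul_invK gmul_Kinv : grp.

(** Elements of [Sc] contain graphs and are compared by Leibniz equality, so mutual inclusion has to
    yield equality; extensionality of predicates provides it. *)
Lemma sameg_eq X G (D D' : graph X G) :
  subg X G D D' -> subg X G D' D -> D = D'.
Proof.
  destruct D as [V E], D' as [V' E']; intros [HV HE] [HV' HE']; cbn in *.
  f_equal; apply functional_extensionality; intro z;
    apply propositional_extensionality; split; auto.
Qed.

Lemma subg_refl X G D : subg X G D D.
Proof. split; auto. Qed.

Lemma subg_trans X G D1 D2 D3 :
  subg X G D1 D2 -> subg X G D2 D3 -> subg X G D1 D3.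
Proof. intros [] []; split; auto. Qed.

(** * Inverse monoids *)

Section InverseMonoidLemmas.
Variable S : imdata.
Hypothesis HS : is_inverse_monoid S.
Local Notation D := (idom S).
Local Notation "a * b" := (imul S a b).
Local Notation "a ^-" := (iinv S a) (at level 3, format "a ^-").

Lemma im_1 : D (ione S). Proof. apply HS. Qed.
Lemma im_M a b : D a -> D b -> D (a * b). Proof. apply HS. Qed.
Lemma im_V a : D a -> D (a^-). Proof. apply HS. Qed.
Lemma im_mulA a b c : D a -> D b -> D c -> (a * b) * c = a * (b * c).
Proof. intros. symmetry. apply HS; auto. Qed.
Lemma im_mul1l a : D a -> ione S * a = a. Proof. apply HS. Qed.
Lemma im_mul1r a : D a -> a * ione S = a. Proof. apply HS. Qed.
Lemma im_invK a : D a -> (a^-)^- = a. Proof. apply HS. Qed.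
Lemma im_invM a b : D a -> D b -> (a * b)^- = b^- * a^-. Proof. apply HS. Qed.
Lemma im_regular a : D a -> a * (a^- * a) = a.
Proof. intro. rewrite <- im_mulA by auto using im_V. apply HS; auto. Qed.
Lemma im_comm a b : D a -> D b -> a * a^- * (b * b^-) = b * b^- * (a * a^-).
Proof. apply HS. Qed.

Hint Resolve im_1 im_M im_V : core.

Lemma im_regular_inv a : D a -> a^- * (a * a^-) = a^-.
Proof. intro H. pose proof (im_regular (a^-)) as K. rewrite im_invK in K; auto. Qed.

Lemma im_inv1 : (ione S)^- = ione S.
Proof.
  transitivity ((ione S)^- * ione S); [symmetry; apply im_mul1r; auto|].
  rewrite <- (im_invK (ione S)) at 2 by auto.
  rewrite <- im_invM, im_mul1r, im_invK; auto.
Qed.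

(** The axioms only commute products of the form [a a^-]. As [e^-] is idempotent too, [e = e e^- e =
    (e e^-)(e^- e) = (e^- e)(e e^-) = e^- e e^- = e^-]. *)
Lemma idem_inv e : idem S e -> e^- = e.
Proof.
  intros [He Hee].
  assert (H' : e^- * e^- = e^-) by (rewrite <- im_invM, Hee; auto).
  symmetry. rewrite <- (im_regular e) at 1 by auto.
  rewrite <- H' at 1. rewrite !im_mulA by auto.
  pose proof (im_comm e (e^-)) as K. rewrite im_invK, !im_mulA in K by auto.
  rewrite K by auto. rewrite <- (im_mulA e e) by auto. rewrite Hee.
  apply im_regular_inv; auto.
Qed.

Lemma idem_square e : idem S e -> e = e * e^-.
Proof. intro H. rewrite idem_inv by auto. symmetry. apply H. Qed.

Lemma idem_comm e f : idem S e -> idem S f -> e * f = f * e.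
Proof.
  intros He Hf. rewrite (idem_square e He), (idem_square f Hf).
  apply im_comm; [apply He | apply Hf].
Qed.

Lemma idem_mul_inv a : D a -> idem S (a * a^-).
Proof.
  intro H. split; auto. rewrite im_mulA, im_regular_inv; auto.
Qed.

Lemma idem1 : idem S (ione S).
Proof. split; auto using im_mul1l. Qed.

(** If [s = e t], then [s s^- t = e t t^- e t = e t]. This turns the order into an equation without
    a hidden idempotent, the shape required by [cong_max]. *)
Lemma nat_le_absorb s t : D t -> nat_le S s t -> s * (s^- * t) = s.
Proof.
  intros Ht (e & He & ->). assert (De := proj1 He).
  rewrite im_invM, (idem_inv e He), !im_mulA by auto.
  rewrite <- (im_mulA t (t^-) (e * t)) by auto.
  rewrite <- (im_mulA (t * t^-) e t) by auto.
  rewrite (idem_comm (t * t^-) e) by auto using idem_mul_inv.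
  rewrite !im_mulA, im_regular by auto.
  rewrite <- im_mulA by auto. rewrite (proj2 He). reflexivity.
Qed.

Lemma nat_le_inv s t : D t -> nat_le S s t -> nat_le S (s^-) (t^-).
Proof.
  intros Ht (e & He & ->). assert (De := proj1 He).
  (* The inverse of [e t] is [t^- e]; moving [e] to the left across [t^-] conjugates it to
     [t^- e t]. *)
  exists (t^- * (e * t)). split; [split; auto|].
  - rewrite !im_mulA by auto.
    rewrite <- (im_mulA t (t^-) (e * t)), <- (im_mulA (t * t^-) e t),
      (idem_comm (t * t^-) e) by auto using idem_mul_inv.
    rewrite !im_mulA, im_regular, <- (im_mulA e e t), (proj2 He) by auto. reflexivity.
  - rewrite im_invM, (idem_inv e He), !im_mulA by auto.
    rewrite (idem_comm e (t * t^-)) by auto using idem_mul_inv.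
    rewrite <- !im_mulA, (im_mulA (t^-) t (t^-)), im_regular_inv by auto. reflexivity.
Qed.

Lemma nat_le_antisym s t : D s -> D t -> nat_le S s t -> nat_le S t s -> s = t.
Proof.
  intros Hs Ht (e & He & E1) (f & Hf & E2).
  assert (De := proj1 He). assert (Df := proj1 Hf).
  assert (K : f * s = s).
  { rewrite E1, <- im_mulA, (idem_comm f e), im_mulA by auto.
    rewrite E2 at 1. rewrite <- (im_mulA f f), (proj2 Hf), <- E2 by auto. reflexivity. }
  rewrite E2, K. reflexivity.
Qed.

(** From [1 <= m 1] follows [m 1 = 1]. An element above an idempotent is sigma-related to 1, hence
    lies below [m 1 = 1], hence is idempotent. *)
Lemma max_op_E_unitary m : is_max_op S m -> E_unitary S.
Proof.
  intros Hm e s He Hs (e' & He' & Hes).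
  destruct (Hm (ione S) im_1) as (Dm & _ & Hmax).
  assert (H1 : m (ione S) = ione S).
  { destruct (Hmax (ione S) im_1) as (f & Hf & Hf1).
    - exists (ione S). split; auto using idem1.
    - assert (Df := proj1 Hf).
      (* With [1 = f (m 1)] and [f] idempotent, [f = f 1 = f f (m 1) = f (m 1) = 1]. *)
      assert (H : f = ione S).
      { rewrite <- (im_mul1r f), Hf1, <- im_mulA, (proj2 Hf); auto. }
      rewrite H, im_mul1l in Hf1 by auto. auto. }
  destruct (Hmax s Hs) as (f & Hf & Hf1).
  - exists e. split; auto. assert (De := proj1 He).
    pose proof (nat_le_absorb e s Hs (ex_intro _ e' (conj He' Hes))) as K.
    rewrite idem_inv, <- im_mulA, (proj2 He) in K by auto.
    rewrite K, im_mul1r; auto.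
  - rewrite H1, im_mul1r in Hf1 by apply Hf. rewrite Hf1. exact Hf.
Qed.

End InverseMonoidLemmas.

(** * Paths labelled by letters and jumps *)

Section Tokens.
Variables (X : Type) (G : group) (iG : X -> G).
Variables (J : Type) (jG : J -> G) (jinv : J -> J).
Hypothesis jinvK : forall j, jinv (jinv j) = j.
Hypothesis jG_inv : forall j, jG (jinv j) = ginv G (jG j).

Local Notation "a ** b" := (gmul G a b) (at level 40, left associativity).
Local Notation V := (gV X G).
Local Notation E := (gE X G).
Local Notation lab := (lab X G iG).
Local Notation graph := (graph X G).
Local Notation sub := (subg X G).
Local Notation subgraph := (is_subgraph X G iG).
Local Notation translate := (translate X G).
Local Notation gunion := (gunion X G).
Local Notation single := (single X G).

Definition linv (a : letter X) : letter X :=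
  match a with inl x => inr x | inr x => inl x end.

Lemma linvK a : linv (linv a) = a.
Proof. destruct a; reflexivity. Qed.

Lemma lab_linv a : lab (linv a) = ginv G (lab a).
Proof. destruct a; cbn; [reflexivity | symmetry; apply ginvK]. Qed.

Lemma einvE g a : einv X G iG (g, a) = (g ** lab a, linv a).
Proof. destruct a; reflexivity. Qed.

Definition tok := (letter X + J)%type.

Definition tG (a : tok) : G :=
  match a with inl l => lab l | inr j => jG j end.

Definition tinv (a : tok) : tok :=
  match a with inl l => inl (linv l) | inr j => inr (jinv j) end.

Lemma tG_inv a : tG (tinv a) = ginv G (tG a).
Proof. destruct a; [apply lab_linv | apply jG_inv]. Qed.

Lemma tinvK a : tinv (tinv a) = a.
Proof. destruct a; cbn; [rewrite linvK | rewrite jinvK]; reflexivity. Qed.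

Fixpoint wG (w : list tok) : G :=
  match w with [] => gone G | a :: w' => tG a ** wG w' end.

Lemma wG_app u v : wG (u ++ v) = wG u ** wG v.
Proof.
  induction u as [|a u IH]; cbn; [symmetry; apply gmul1l|].
  rewrite IH. apply gmulA.
Qed.

Definition winv (w : list tok) : list tok := rev (map tinv w).

Lemma winv_app u v : winv (u ++ v) = winv v ++ winv u.
Proof. unfold winv. rewrite map_app, rev_app_distr. reflexivity. Qed.

Lemma winvK w : winv (winv w) = w.
Proof.
  unfold winv. rewrite map_rev, rev_involutive, map_map.
  rewrite <- (map_id w) at 2. apply map_ext, tinvK.
Qed.

Lemma wG_inv w : wG (winv w) = ginv G (wG w).
Proof.
  induction w as [|a w IH]; [symmetry; apply ginv1|].
  change (a :: w) with ([a] ++ w). rewrite winv_app, !wG_app, IH, ginvM.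
  f_equal. cbn. rewrite tG_inv. gnorm.
Qed.

(** A jump moves by [jG j] without using an edge. In a subgraph only its two ends have to be
    vertices; its target is checked by the rest of the word. *)
Fixpoint tpath (D : graph) (g : G) (w : list tok) (h : G) : Prop :=
  match w with
  | [] => V D g /\ g = h
  | inl a :: w' => E D (g, a) /\ tpath D (g ** lab a) w' h
  | inr j :: w' => V D g /\ tpath D (g ** jG j) w' h
  end.

(* Connectedness where jumps count as steps: this is [PCSub] when [J] is empty,
   and [PSub] when every element of [G] is the value of a jump. *)
Definition tconnected (D : graph) : Prop :=
  subgraph D /\ nonempty X G D /\
  forall g h, V D g -> V D h -> exists w, tpath D g w h.

Lemma tpath_end D g w h : tpath D g w h -> h = g ** wG w.
Proof.
  revert g; induction w as [|[a|j] w IH]; cbn; intros g [H1 H2].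
  - rewrite gmul1r. auto.
  - rewrite gmulA. auto.
  - rewrite gmulA. auto.
Qed.

Lemma tpath_src D g w h : subgraph D -> tpath D g w h -> V D g.
Proof.
  intros HD. destruct w as [|[a|j] w]; cbn; intros [H1 H2]; auto.
  exact (proj1 (HD _ H1)).
Qed.

Lemma tpath_tgt D g w h : tpath D g w h -> V D h.
Proof.
  revert g; induction w as [|[a|j] w IH]; cbn; intros g [H1 H2]; eauto.
  congruence.
Qed.

Lemma tpath_mono D D' g w h : sub D D' -> tpath D g w h -> tpath D' g w h.
Proof.
  intros [HV HE]. revert g; induction w as [|[a|j] w IH]; cbn; intros g [H1 H2]; auto.
Qed.

Lemma tpath_app D g u v h : subgraph D ->
  tpath D g (u ++ v) h <-> tpath D g u (g ** wG u) /\ tpath D (g ** wG u) v h.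
Proof.
  intro HD. revert g; induction u as [|[a|j] u IH]; intros g; cbn.
  - rewrite gmul1r. split; [|tauto]. intro H. pose proof (tpath_src _ _ _ _ HD H). tauto.
  - rewrite IH, gmulA. tauto.
  - rewrite IH, gmulA. tauto.
Qed.

Lemma tpath_cat D g u k v h : subgraph D ->
  tpath D g u k -> tpath D k v h -> tpath D g (u ++ v) h.
Proof.
  intros HD H1 H2. apply tpath_app; auto.
  pose proof (tpath_end _ _ _ _ H1); subst k. auto.
Qed.

Lemma tpath_inv D g w h : subgraph D -> tpath D g w h -> tpath D h (winv w) g.
Proof.
  intro HD. revert g; induction w as [|[a|j] w IH]; intros g [H1 H2].
  - subst. cbn. auto.
  - change (inl a :: w) with ([inl a : tok] ++ w). rewrite winv_app.
    apply tpath_cat with (g ** lab a); auto.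
    cbn. rewrite lab_linv. rewrite <- gmulA, gmulVr, gmul1r.
    rewrite <- einvE. destruct (HD _ H1) as (? & ? & ?). auto.
  - change (inr j :: w) with ([inr j : tok] ++ w). rewrite winv_app.
    apply tpath_cat with (g ** jG j); auto.
    cbn. rewrite jG_inv. rewrite <- gmulA, gmulVr, gmul1r.
    pose proof (tpath_src _ _ _ _ HD H2). auto.
Qed.

(** * Finite graphs spanned by words *)

Definition edge_graph (g : G) (a : letter X) : graph :=
  (fun v => v = g \/ v = g ** lab a,
   fun e => e = (g, a) \/ e = einv X G iG (g, a)).

(* [span (gone G) w] is the graph <w> of the paper. *)
Fixpoint span (g : G) (w : list tok) : graph :=
  match w with
  | [] => single g
  | inl a :: w' => gunion (edge_graph g a) (span (g ** lab a) w')
  | inr j :: w' => gunion (single g) (span (g ** jG j) w')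
  end.

Lemma subgraph_union D D' : subgraph D -> subgraph D' -> subgraph (gunion D D').
Proof.
  intros H H' e [He|He]; [destruct (H _ He) as (?&?&?)|destruct (H' _ He) as (?&?&?)];
    cbn; auto.
Qed.

Lemma subgraph_single g : subgraph (single g).
Proof. intros e []. Qed.

Lemma subgraph_edge g a : subgraph (edge_graph g a).
Proof.
  intros e [->| ->]; rewrite ?einvE; cbn; rewrite ?einvE.
  - auto.
  - unfold esrc, etgt; cbn. rewrite lab_linv, linvK. gnorm. auto.
Qed.

Lemma sub_unionl D D' : sub D (gunion D D').
Proof. split; cbn; auto. Qed.

Lemma sub_unionr D D' : sub D' (gunion D D').
Proof. split; cbn; auto. Qed.

Lemma sub_union D D' D'' : sub D D'' -> sub D' D'' -> sub (gunion D D') D''.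
Proof. intros [] []; split; cbn; intros ? []; auto. Qed.

Lemma subgraph_span g w : subgraph (span g w).
Proof.
  revert g; induction w as [|[a|j] w IH]; intro g; cbn.
  - apply subgraph_single.
  - apply subgraph_union; auto using subgraph_edge.
  - apply subgraph_union; auto using subgraph_single.
Qed.

Lemma tpath_span g w : tpath (span g w) g w (g ** wG w).
Proof.
  revert g; induction w as [|[a|j] w IH]; intro g; cbn.
  - split; auto. symmetry; apply gmul1r.
  - split; [left; left; reflexivity|]. rewrite gmulA.
    eapply tpath_mono; [apply sub_unionr | apply IH].
  - split; [left; reflexivity|]. rewrite gmulA.
    eapply tpath_mono; [apply sub_unionr | apply IH].
Qed.

Lemma span_sub D g w h : subgraph D -> tpath D g w h -> sub (span g w) D.
Proof.
  intro HD. revert g; induction w as [|[a|j] w IH]; cbn; intros g [H1 H2].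
  - split; cbn; [intros; subst; auto | tauto].
  - apply sub_union; auto. destruct (HD _ H1) as (?&?&?).
    split; cbn; intros z [->| ->]; auto.
  - apply sub_union; auto. split; cbn; [intros; subst; auto | tauto].
Qed.

Lemma span_tpath D g w : sub (span g w) D -> tpath D g w (g ** wG w).
Proof. intro H. eapply tpath_mono; [exact H | apply tpath_span]. Qed.

Lemma span_src g w : V (span g w) g.
Proof. apply (tpath_src _ _ _ _ (subgraph_span g w) (tpath_span g w)). Qed.

Lemma span_tgt g w : V (span g w) (g ** wG w).
Proof. apply (tpath_tgt _ _ _ _ (tpath_span g w)). Qed.

Lemma span_tgt1 w : V (span (gone G) w) (wG w).
Proof. pose proof (span_tgt (gone G) w) as H. rewrite gmul1l in H. exact H. Qed.

Lemma span_app g u v : span g (u ++ v) = gunion (span g u) (span (g ** wG u) v).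
Proof.
  apply sameg_eq.
  - apply span_sub with (g ** wG (u ++ v));
      [apply subgraph_union; apply subgraph_span|].
    apply tpath_app; [apply subgraph_union; apply subgraph_span|].
    split; [apply span_tpath, sub_unionl|].
    rewrite wG_app, gmulA. apply span_tpath, sub_unionr.
  - pose proof (tpath_span g (u ++ v)) as H.
    apply tpath_app in H; [|apply subgraph_span]. destruct H.
    apply sub_union; eapply span_sub; eauto using subgraph_span.
Qed.

Lemma span_inv g w : span (g ** wG w) (winv w) = span g w.
Proof.
  apply sameg_eq.
  - apply span_sub with g; [apply subgraph_span|].
    apply tpath_inv; [apply subgraph_span | apply tpath_span].
  - apply span_sub with (g ** wG w); [apply subgraph_span|].
    rewrite <- (winvK w) at 3.
    apply tpath_inv; [apply subgraph_span |].
    assert (H : g = g ** wG w ** wG (winv w)) by (rewrite wG_inv; gnorm).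
    rewrite H at 3. apply tpath_span.
Qed.

Lemma finite_union D D' :
  finite_graph X G D -> finite_graph X G D' -> finite_graph X G (gunion D D').
Proof.
  intros (lv & le & H1 & H2) (lv' & le' & H1' & H2').
  exists (lv ++ lv'), (le ++ le').
  split; intros z [Hz|Hz]; apply in_or_app; [left|right|left|right]; auto.
Qed.

Lemma finite_span g w : finite_graph X G (span g w).
Proof.
  assert (Hs : forall g, finite_graph X G (single g)).
  { intro k. exists [k], []. cbn. split; [intros v ->; auto | tauto]. }
  revert g; induction w as [|[a|j] w IH]; intro g; cbn; auto using finite_union.
  apply finite_union; auto.
  exists [g; g ** lab a], [(g, a); einv X G iG (g, a)].
  cbn. split; intros z [->| ->]; auto.
Qed.

Lemma span_reach g w v : V (span g w) v -> exists p, tpath (span g w) g p v.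
Proof.
  revert g; induction w as [|[a|j] w IH]; intros g; cbn [span].
  - cbn. intros ->. exists []. cbn. auto.
  - intro H. set (D := gunion (edge_graph g a) (span (g ** lab a) w)).
    assert (HE : E D (g, a)) by (left; left; reflexivity).
    assert (HD : subgraph D) by exact (subgraph_span g (inl a :: w)).
    destruct H as [[->| ->]|H].
    + exists []. split; [exact (proj1 (HD _ HE)) | reflexivity].
    + exists [inl a]. split; auto. split; auto. exact (proj1 (proj2 (HD _ HE))).
    + destruct (IH _ H) as [p Hp]. exists (inl a :: p). split; auto.
      eapply tpath_mono; [apply sub_unionr | exact Hp].
  - intros [->|H].
    + exists []. split; cbn; auto.
    + destruct (IH _ H) as [p Hp]. exists (inr j :: p). split; [left; reflexivity|].
      eapply tpath_mono; [apply sub_unionr | exact Hp].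
Qed.

Lemma tconnected_root D k : subgraph D -> V D k ->
  (forall v, V D v -> exists p, tpath D k p v) -> tconnected D.
Proof.
  intros HD Hk H. split; [exact HD|split; [exists k; exact Hk|]].
  intros g h Hg Hh. destruct (H g Hg) as [p Hp], (H h Hh) as [q Hq].
  exists (winv p ++ q). apply tpath_cat with k; auto. apply tpath_inv; auto.
Qed.

Lemma tconnected_span g w : tconnected (span g w).
Proof.
  apply tconnected_root with g; auto using subgraph_span, span_src, span_reach.
Qed.

Lemma tconnected_union D D' k : tconnected D -> tconnected D' ->
  V D k -> V D' k -> tconnected (gunion D D').
Proof.
  intros (H1 & _ & H2) (H1' & _ & H2') Hk Hk'.
  apply tconnected_root with k; [apply subgraph_union; auto | left; auto|].
  intros v [Hv|Hv].
  - destruct (H2 _ _ Hk Hv) as [p Hp]. exists p.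
    eapply tpath_mono; [apply sub_unionl | exact Hp].
  - destruct (H2' _ _ Hk' Hv) as [p Hp]. exists p.
    eapply tpath_mono; [apply sub_unionr | exact Hp].
Qed.

(** Each vertex or edge of [F] is absorbed by putting an excursion [p] and its return [winv p] in
    front of the loop found so far. With [D = F] this writes a finite connected graph as the span of
    a word, so closures of finite graphs become closures of words. *)
Lemma covering_loop D F k : tconnected D -> V D k ->
  finite_graph X G F -> sub F D -> exists u, tpath D k u k /\ sub F (span k u).
Proof.
  intros (HD & _ & HC) Hk (lv & le & Hlv & Hle) [FV FE].
  assert (Hext : forall u p h, tpath D k u k -> tpath D k p h ->
    tpath D k (p ++ winv p ++ u) k /\ sub (span k u) (span k (p ++ winv p ++ u)) /\
    sub (span k p) (span k (p ++ winv p ++ u))).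
  { intros u p h Hu Hp. split; [|split].
    - apply tpath_cat with h; auto. apply tpath_cat with k; auto. apply tpath_inv; auto.
    - rewrite !span_app. eapply subg_trans; [|apply sub_unionr].
      replace (k ** wG p ** wG (winv p)) with k by (rewrite wG_inv; gnorm).
      apply sub_unionr.
    - rewrite span_app. apply sub_unionl. }
  assert (H : exists u, tpath D k u k /\
     (forall v, In v lv -> V D v -> V (span k u) v)).
  { clear Hlv. induction lv as [|v lv (u & Hu & IH)].
    - exists []. split; [split; auto | intros ? []].
    (* [finite_graph] only bounds [F] by lists, which may contain points outside [D]; these are
       skipped. *)
    - destruct (classic (V D v)) as [Hv|Hv].
      + destruct (HC _ _ Hk Hv) as [p Hp].
        destruct (Hext u p v Hu Hp) as (E1 & E2 & E3).
        eexists; split; [exact E1|]. intros v' [<-|Hi] Hv'.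
        * apply (proj1 E3). rewrite (tpath_end _ _ _ _ Hp). apply span_tgt.
        * apply (proj1 E2); auto.
      + exists u. split; auto. intros v' [<-|Hi] Hv'; [contradiction | auto]. }
  destruct H as (u & Hu & HV).
  assert (H : exists u, tpath D k u k /\
     (forall v, In v lv -> V D v -> V (span k u) v) /\
     (forall e, In e le -> E D e -> E (span k u) e)).
  { clear Hle. induction le as [|e le (u' & Hu' & IV & IE)].
    - exists u. split; [auto | split; [auto | intros ? []]].
    - destruct (classic (E D e)) as [He|He].
      + destruct e as [g a]. destruct (HD _ He) as (Hs & Ht & _).
        destruct (HC _ _ Hk Hs) as [p Hp]. cbn in Hp.
        assert (Hp' : tpath D k (p ++ [inl a]) (g ** lab a)).
        { apply tpath_cat with g; auto. split; [exact He | split; [exact Ht | reflexivity]]. }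
        destruct (Hext u' _ _ Hu' Hp') as (E1 & E2 & E3).
        eexists; split; [exact E1|]. split.
        * intros v Hi Hv. apply (proj1 E2); auto.
        * intros e [<-|Hi] He'; [|apply (proj2 E2); auto].
          apply (proj2 E3). rewrite span_app. right.
          pose proof (tpath_end _ _ _ _ Hp) as <-. left; left; reflexivity.
      + exists u'. split; [auto | split; [auto|]].
        intros e' [<-|Hi] He'; [contradiction | auto]. }
  destruct H as (u' & Hu' & HV' & HE'). exists u'. split; auto. split; auto.
Qed.

(** * Translation by group elements and invariance of closures *)

Lemma translateV k D v : V (translate k D) (k ** v) <-> V D v.
Proof. cbn. rewrite gmul_invK. tauto. Qed.

Lemma translateE k D v a : E (translate k D) (k ** v, a) <-> E D (v, a).
Proof. cbn. rewrite gmul_invK. tauto. Qed.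

Lemma sub_translate k D D' : sub D D' -> sub (translate k D) (translate k D').
Proof. intros []; split; cbn; auto. Qed.

Lemma translate_translate k k' D : translate k (translate k' D) = translate (k ** k') D.
Proof.
  apply sameg_eq; split; cbn; intros z; rewrite ginvM, <- gmulA; auto.
Qed.

Lemma translate1 D : translate (gone G) D = D.
Proof.
  apply sameg_eq; split; cbn; intros z; rewrite ginv1, gmul1l; auto;
  destruct z; auto.
Qed.

Lemma translateVK k D : translate (ginv G k) (translate k D) = D.
Proof. rewrite translate_translate, gmulVl. apply translate1. Qed.

Lemma translateKV k D : translate k (translate (ginv G k) D) = D.
Proof. rewrite translate_translate, gmulVr. apply translate1. Qed.

Lemma subgraph_translate k D : subgraph D -> subgraph (translate k D).
Proof.
  intros HD [g a] H. rewrite einvE. unfold esrc, etgt. cbn in *.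
  destruct (HD _ H) as (H1 & H2 & H3). rewrite einvE in H3.
  unfold esrc, etgt in *; cbn in *. rewrite gmulA. auto.
Qed.

Lemma tpath_translate k D g w h :
  tpath (translate k D) (k ** g) w (k ** h) <-> tpath D g w h.
Proof.
  revert g; induction w as [|[a|j] w IH]; intro g; cbn [tpath].
  - rewrite translateV. split; intros [H1 H2]; split; auto.
    + apply gmul_injl in H2; auto.
    + congruence.
  - rewrite translateE, <- gmulA, IH. tauto.
  - rewrite translateV, <- gmulA, IH. tauto.
Qed.

Lemma tconnected_translate k D : tconnected D -> tconnected (translate k D).
Proof.
  intros (H1 & (v & Hv) & H2). split; [apply subgraph_translate; auto|split].
  - exists (k ** v). apply translateV; auto.
  - intros g h Hg Hh. rewrite <- (gmul_Kinv G k g), <- (gmul_Kinv G k h) in *.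
    apply translateV in Hg, Hh. destruct (H2 _ _ Hg Hh) as [w Hw]. exists w.
    apply tpath_translate; auto.
Qed.

Lemma translate_span k g w : translate k (span g w) = span (k ** g) w.
Proof.
  assert (H : forall k g, sub (span (k ** g) w) (translate k (span g w))).
  { intros k' g'. apply span_sub with (k' ** (g' ** wG w)).
    - apply subgraph_translate, subgraph_span.
    - apply tpath_translate, tpath_span. }
  apply sameg_eq; auto.
  rewrite <- (translateKV k (span (k ** g) w)). apply sub_translate.
  specialize (H (ginv G k) (k ** g)). rewrite gmul_invK in H. exact H.
Qed.

Definition tclosed (R : list tok -> list tok -> Prop) (D : graph) : Prop :=
  forall u v, R u v -> forall g h, V D g -> V D h -> (tpath D g u h <-> tpath D g v h).

Lemma tclosed_translate R k D : tclosed R D -> tclosed R (translate k D).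
Proof.
  intros H u v Huv g h Hg Hh.
  rewrite <- (gmul_Kinv G k g), <- (gmul_Kinv G k h) in *.
  apply translateV in Hg, Hh. rewrite !tpath_translate. auto.
Qed.

Lemma represents_closure P closed c :
  represents X G P c closed -> is_closure_op X G P c.
Proof.
  intro H. split; [|split; [|split]].
  - intros D HD. apply (H D HD).
  - intros D HD. apply (H D HD).
  - intros D D' HD HD' Hs. destruct (H D HD) as (_ & _ & _ & Hm).
    destruct (H D' HD') as (? & ? & ? & _). apply Hm; auto.
    eapply subg_trans; eauto.
  - intros D HD. destruct (H D HD) as (H1 & H2 & H3 & _).
    destruct (H _ H1) as (_ & _ & ? & Hm).
    split; auto. apply Hm; auto using subg_refl.
Qed.

(** A translate of a closed graph is closed, so minimality gives the inclusion of
    [c (translate g D)] in [translate g (c D)]. The same inclusion for the inverse of [g],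
    translated back, is the other one. *)
Lemma represents_invariant R c :
  represents X G tconnected c (tclosed R) -> G_invariant X G tconnected c.
Proof.
  intros H.
  assert (Hs : forall g D, tconnected D -> sub (c (translate g D)) (translate g (c D))).
  { intros g D HD. destruct (H D HD) as (H1 & H2 & H3 & _).
    destruct (H _ (tconnected_translate g D HD)) as (_ & _ & _ & Hm).
    apply Hm; auto using tconnected_translate, tclosed_translate, sub_translate. }
  intros g D HD. split; auto.
  rewrite <- (translateKV g (c (translate g D))). apply sub_translate.
  pose proof (Hs (ginv G g) _ (tconnected_translate g D HD)) as K.
  rewrite translateVK in K. exact K.
Qed.

(** * Closed graphs of a congruence *)

(* [cong_max] says that [inr j] is the greatest element of the class of [jG j]. *)
Record congruence (R : list tok -> list tok -> Prop) : Prop := {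
  cong_equiv : Equivalence R;
  cong_app : forall u u' v v', R u u' -> R v v' -> R (u ++ v) (u' ++ v');
  cong_winv : forall u v, R u v -> R (winv u) (winv v);
  cong_regular : forall u, R (u ++ winv u ++ u) u;
  cong_comm : forall u v, R (u ++ winv u ++ v ++ winv v) (v ++ winv v ++ u ++ winv u);
  cong_wG : forall u v, R u v -> wG u = wG v;
  cong_E_unitary : forall u, wG u = gone G -> R (u ++ u) u;
  cong_max : forall u j, wG u = jG j -> R (u ++ winv u ++ [inr j]) u }.

Section Congruence.
Variable R : list tok -> list tok -> Prop.
Hypothesis HR : congruence R.

Local Notation "u == v" := (R u v) (at level 70).
Local Notation "u ^-" := (winv u) (at level 3, format "u ^-").

#[local] Instance R_equiv : Equivalence R := cong_equiv R HR.
#[local] Instance R_app : Proper (R ==> R ==> R) (@app tok).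
Proof. intros u u' H v v' H'. apply (cong_app R HR); auto. Qed.
#[local] Instance R_winv : Proper (R ==> R) winv.
Proof. intros u u' H. apply (cong_winv R HR); auto. Qed.

(** * Calculus of idempotents modulo the congruence *)

Lemma regular_tail u t : u ++ u^- ++ u ++ t == u ++ t.
Proof.
  pose proof (cong_regular R HR u) as H.
  replace (u ++ u^- ++ u ++ t) with ((u ++ u^- ++ u) ++ t)
    by (rewrite <- !app_assoc; reflexivity).
  rewrite H. reflexivity.
Qed.

Lemma regular_inv_tail u t : u^- ++ u ++ u^- ++ t == u^- ++ t.
Proof. pose proof (regular_tail (u^-) t) as H. rewrite winvK in H. exact H. Qed.

Lemma regular_inv u : u^- ++ u ++ u^- == u^-.
Proof. pose proof (cong_regular R HR (u^-)) as H. rewrite winvK in H. exact H. Qed.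

Lemma comm_tail u v t : u ++ u^- ++ v ++ v^- ++ t == v ++ v^- ++ u ++ u^- ++ t.
Proof.
  pose proof (cong_comm R HR u v) as H.
  replace (u ++ u^- ++ v ++ v^- ++ t) with ((u ++ u^- ++ v ++ v^-) ++ t)
    by (rewrite <- !app_assoc; reflexivity).
  rewrite H, <- !app_assoc. reflexivity.
Qed.

(** The computation of [idem_inv], carried out on words modulo [R]. *)
Lemma idem_winv z : z ++ z == z -> z^- == z.
Proof.
  intro H.
  assert (H' : z^- ++ z^- == z^-) by (rewrite <- winv_app, H; reflexivity).
  symmetry. rewrite <- (cong_regular R HR z) at 1.
  rewrite <- H' at 1. rewrite <- app_assoc.
  pose proof (cong_comm R HR z (z^-)) as K. rewrite winvK in K. rewrite K.
  replace (z^- ++ z ++ z ++ z^-) with (z^- ++ (z ++ z) ++ z^-)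
    by (rewrite <- !app_assoc; reflexivity).
  rewrite H. apply regular_inv.
Qed.

(** The word [z = x^- y] has image 1, so it is idempotent by E-unitarity and equals its inverse.
    Since [x z == y] and [y z^- == x], one gets [x == y z == x z z == x z == y]. *)
Lemma R_related_eq x y : x ++ x^- == y ++ y^- -> wG x = wG y -> x == y.
Proof.
  intros H HG. set (z := x^- ++ y).
  assert (Hz : z ++ z == z).
  { apply (cong_E_unitary R HR). unfold z. rewrite wG_app, wG_inv, HG. apply gmulVl. }
  assert (H1 : x ++ z == y).
  { unfold z. rewrite app_assoc, H, <- app_assoc. apply (cong_regular R HR). }
  assert (H2 : y ++ z^- == x).
  { unfold z. rewrite winv_app, winvK, app_assoc, <- H, <- app_assoc.
    apply (cong_regular R HR). }
  rewrite <- H2 at 1. rewrite (idem_winv z Hz), <- H1, <- app_assoc, Hz. reflexivity.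
Qed.

(* [le w u] is the order of idempotents [w w^-1 <= u u^-1]. *)
Definition le (w u : list tok) : Prop := w ++ w^- ++ u ++ u^- == w ++ w^-.

Lemma le_tail w u t : le w u -> w ++ w^- ++ u ++ u^- ++ t == w ++ w^- ++ t.
Proof.
  intro H. unfold le in H.
  replace (w ++ w^- ++ u ++ u^- ++ t) with ((w ++ w^- ++ u ++ u^-) ++ t)
    by (rewrite <- !app_assoc; reflexivity).
  rewrite H, <- app_assoc. reflexivity.
Qed.

(** Commuting idempotents gives [(w w^- u)(w w^- u)^- == w w^- u u^-]. In this form the order can be
    fed to [R_related_eq]. *)
Lemma le_iff w u :
  le w u <-> (w ++ w^- ++ u) ++ (w ++ w^- ++ u)^- == w ++ w^-.
Proof.
  unfold le. rewrite !winv_app, winvK, <- !app_assoc.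
  rewrite (cong_comm R HR u w), regular_tail. tauto.
Qed.

Lemma le_refl w : le w w.
Proof. unfold le. rewrite regular_tail. reflexivity. Qed.

Lemma le_nil w : le w [].
Proof. unfold le. cbn. rewrite app_nil_r. reflexivity. Qed.

Lemma le_trans w u t : le w u -> le u t -> le w t.
Proof.
  intros H1 H2. unfold le.
  rewrite <- (le_tail w u (t ++ t^-) H1). unfold le in H2. rewrite H2. exact H1.
Qed.

Lemma le_meet_l w w' : le (w ++ w^- ++ w') w.
Proof.
  unfold le. rewrite !winv_app, winvK, <- !app_assoc.
  rewrite (regular_tail w (w^-)). reflexivity.
Qed.

Lemma le_meet_r w w' : le (w ++ w^- ++ w') w'.
Proof.
  unfold le. rewrite !winv_app, winvK, <- !app_assoc.
  rewrite (cong_comm R HR w w'), regular_inv_tail. reflexivity.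
Qed.

Lemma le_R w u v : u == v -> le w u -> le w v.
Proof. unfold le. intros H. rewrite H. auto. Qed.

(** Replace [w w^-] by [w w^- u v v^- u^-]; its final [u^-] absorbs [u u^-]. *)
Lemma le_prefix w u v : le w (u ++ v) -> le w u.
Proof.
  intro H. unfold le. unfold le in H. rewrite winv_app, <- app_assoc in H.
  replace (w ++ w^- ++ u ++ u^-) with ((w ++ w^-) ++ u ++ u^-)
    by (rewrite <- !app_assoc; reflexivity).
  rewrite <- H at 1. rewrite <- !app_assoc, regular_inv. exact H.
Qed.

Lemma le_eq w u u' : le w u -> le w u' -> wG u = wG u' -> w ++ w^- ++ u == w ++ w^- ++ u'.
Proof.
  intros H H' HG. apply le_iff in H, H'. apply R_related_eq.
  - rewrite H, H'. reflexivity.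
  - rewrite !wG_app, HG. reflexivity.
Qed.

Lemma le_replace w u u' v :
  le w u -> le w u' -> wG u = wG u' -> le w (u ++ v) -> le w (u' ++ v).
Proof.
  intros H H' HG Hv. pose proof (le_eq w u u' H H' HG) as K.
  apply le_iff in Hv. apply le_iff.
  assert (K' : w ++ w^- ++ u ++ v == w ++ w^- ++ u' ++ v).
  { replace (w ++ w^- ++ u ++ v) with ((w ++ w^- ++ u) ++ v)
      by (rewrite <- !app_assoc; reflexivity).
    rewrite K, <- !app_assoc. reflexivity. }
  rewrite <- K'. exact Hv.
Qed.

Lemma le_winv w u v : le w (u ++ v) -> le w (u ++ v ++ v^-).
Proof.
  unfold le. rewrite !winv_app, winvK, <- !app_assoc.
  rewrite (regular_tail v (v^- ++ u^-)). auto.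
Qed.

(* [z = u^-1 w w^-1 u'] lies below [j], which gives [w w^-1 u' = w w^-1 u j]. *)
Lemma le_jump w u u' j :
  le w u -> le w u' -> wG u' = gmul G (wG u) (jG j) -> le w (u ++ [inr j]).
Proof.
  intros H H' HG. set (z := u^- ++ w ++ w^- ++ u').
  assert (Hz : z ++ z^- ++ [inr j] == z).
  { apply (cong_max R HR). unfold z. rewrite !wG_app, !wG_inv, HG. gnorm. }
  set (x := w ++ w^- ++ u').
  assert (Hx : u ++ z == x).
  { unfold z. rewrite (comm_tail u w u'). unfold x. apply le_tail; auto. }
  assert (K : x == w ++ w^- ++ u ++ [inr j]).
  { rewrite <- Hx at 1. rewrite <- Hz.
    rewrite <- (regular_tail u (z ++ z^- ++ [inr j])).
    pose proof (comm_tail (u^-) z [inr j]) as C. rewrite winvK in C. rewrite C.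
    replace (u ++ z ++ z^- ++ u^- ++ u ++ [inr j])
      with ((u ++ z) ++ (u ++ z)^- ++ u ++ [inr j])
      by (rewrite winv_app, <- !app_assoc; reflexivity).
    rewrite Hx. apply le_iff in H'. fold x in H'. rewrite app_assoc, H', <- app_assoc.
    reflexivity. }
  apply le_iff. rewrite <- K. apply le_iff in H'. exact H'.
Qed.

(** The idempotents [w w^-] and [p^- p] commute, and [p p^- p] collapses. This serves to move the
    base vertex of a closure along a path [p]. *)
Lemma le_prefix_app p w u : le w u -> le (p ++ w) (p ++ u).
Proof.
  unfold le. intro H. rewrite !winv_app, <- !app_assoc.
  pose proof (comm_tail w (p^-) (u ++ u^- ++ p^-)) as C. rewrite winvK in C.
  rewrite C, regular_tail. rewrite (le_tail w u (p^-) H). reflexivity.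
Qed.

(* The properties of the set of words that can be read from a fixed vertex of
   a closed graph. *)
Record readable (Q : list tok -> Prop) : Prop := {
  read_nil : Q [];
  read_prefix : forall u v, Q (u ++ v) -> Q u;
  read_replace : forall u u' v,
    Q u -> Q u' -> wG u = wG u' -> Q (u ++ v) -> Q (u' ++ v);
  read_jump : forall u u' j,
    Q u -> Q u' -> wG u' = gmul G (wG u) (jG j) -> Q (u ++ [inr j]);
  read_winv : forall u v, Q (u ++ v) -> Q (u ++ v ++ v^-);
  read_R : forall u v, u == v -> Q u -> Q v }.

Lemma readable_le w : readable (le w).
Proof.
  split.
  - apply le_nil.
  - apply le_prefix.
  - apply le_replace.
  - apply le_jump.
  - apply le_winv.
  - apply le_R.
Qed.

(** For [Q = le w] this is the Schützenberger graph of the idempotent [w w^-], placed inside the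
    Cayley graph with its base at [k]. *)
Definition read_graph (k : G) (Q : list tok -> Prop) : graph :=
  (fun v => exists u, Q u /\ v = k ** wG u,
   fun e => exists u, Q (u ++ [inl (snd e)]) /\ fst e = k ** wG u).

Lemma subgraph_read k Q : readable Q -> subgraph (read_graph k Q).
Proof.
  intros HQ [g a] (u & H & Hg). cbn in *. rewrite einvE. unfold esrc, etgt. cbn. subst g.
  assert (Ha : wG (u ++ [inl a]) = wG u ** lab a) by (rewrite wG_app; cbn; gnorm).
  split; [|split].
  - exists u. split; auto. exact (read_prefix Q HQ _ _ H).
  - exists (u ++ [inl a]). rewrite Ha, gmulA. auto.
  - exists (u ++ [inl a]). rewrite Ha, gmulA. split; auto.
    rewrite <- app_assoc. apply (read_winv Q HQ u [inl a] H).
Qed.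

(** An edge or vertex of the graph may be witnessed by a word [u'] other than the one read so far,
    but with the same value in [G]. For an edge [read_replace] passes from [u'] back to [u]; for the
    target of a jump [read_jump] does so. *)
Lemma tpath_read k Q u v h : readable Q -> Q u ->
  tpath (read_graph k Q) (k ** wG u) v h <-> h = k ** wG u ** wG v /\ Q (u ++ v).
Proof.
  intro HQ. revert u; induction v as [|[a|j] v IH]; intros u Hu.
  - cbn. rewrite gmul1r, app_nil_r. split; intros [H1 H2]; split; auto.
    exists u; auto.
  - assert (Ha : wG (u ++ [inl a]) = wG u ** lab a) by (rewrite wG_app; cbn; gnorm).
    pose proof (app_assoc u [inl a : tok] v) as Hv. cbn [app] in Hv. rewrite Hv.
    cbn [tpath]. rewrite <- gmulA, <- Ha. split.
    + intros [(u' & H1 & H2) H3]. cbn in H1, H2. apply gmul_injl in H2.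
      assert (H : Q (u ++ [inl a])).
      { apply (read_replace Q HQ u'); auto. exact (read_prefix Q HQ _ _ H1). }
      apply IH in H3; auto. rewrite Ha in H3. cbn [wG tG].
      rewrite !gmulA. rewrite !gmulA in H3. exact H3.
    + intros [H1 H2]. pose proof (read_prefix Q HQ _ _ H2) as H3. split.
      * exists u. auto.
      * apply IH; auto. split; auto. rewrite H1, Ha. cbn [wG tG]. gnorm.
  - assert (Ha : wG (u ++ [inr j]) = wG u ** jG j) by (rewrite wG_app; cbn; gnorm).
    pose proof (app_assoc u [inr j : tok] v) as Hv. cbn [app] in Hv. rewrite Hv.
    cbn [tpath]. rewrite <- gmulA, <- Ha. split.
    + intros [_ H3].
      destruct (tpath_src _ _ _ _ (subgraph_read k Q HQ) H3) as (u' & H1 & H2).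
      apply gmul_injl in H2. rewrite Ha in H2.
      assert (H : Q (u ++ [inr j])) by (apply (read_jump Q HQ u u'); auto).
      apply IH in H3; auto. rewrite Ha in H3. cbn [wG tG].
      rewrite !gmulA. rewrite !gmulA in H3. exact H3.
    + intros [H1 H2]. pose proof (read_prefix Q HQ _ _ H2) as H3. split.
      * exists u. auto.
      * apply IH; auto. split; auto. rewrite H1, Ha. cbn [wG tG]. gnorm.
Qed.

Lemma tpath_read1 k Q v h : readable Q ->
  tpath (read_graph k Q) k v h <-> h = k ** wG v /\ Q v.
Proof.
  intro HQ. pose proof (tpath_read k Q [] v h HQ (read_nil Q HQ)) as H.
  cbn in H. rewrite gmul1r in H. exact H.
Qed.

Lemma read_graph_root k Q : readable Q -> V (read_graph k Q) k.
Proof. intro HQ. exists []. cbn. rewrite gmul1r. split; auto. apply (read_nil Q HQ). Qed.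

Lemma tconnected_read k Q : readable Q -> tconnected (read_graph k Q).
Proof.
  intro HQ.
  apply tconnected_root with k; auto using subgraph_read, read_graph_root.
  intros v (u & Hu & ->). exists u. apply tpath_read1; auto.
Qed.

Lemma tclosed_read k Q : readable Q -> tclosed R (read_graph k Q).
Proof.
  intros HQ x y Hxy g h (u & Hu & ->) _. rewrite !tpath_read; auto.
  rewrite (cong_wG R HR _ _ Hxy).
  split; intros [H1 H2]; split; auto; revert H2; apply (read_R Q HQ); rewrite Hxy;
    reflexivity.
Qed.

(** * The closure operator of a congruence *)

Definition read_at (D : graph) (k : G) (u : list tok) : Prop :=
  exists w h, tpath D k w h /\ le w u.

(** The word [w w^- w'] again labels a path from [k], because [w w^-] is a loop, and its idempotent
    lies below those of [w] and [w']. *)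
Lemma read_at_directed D k u u' : subgraph D -> read_at D k u -> read_at D k u' ->
  exists w h, tpath D k w h /\ le w u /\ le w u'.
Proof.
  intros HD (w & h & Hw & Hu) (w' & h' & Hw' & Hu').
  exists (w ++ w^- ++ w'), h'. split; [|split].
  - apply tpath_cat with h; auto. apply tpath_cat with k; auto. apply tpath_inv; auto.
  - eapply le_trans; [apply le_meet_l | auto].
  - eapply le_trans; [apply le_meet_r | auto].
Qed.

(** Each clause involves at most two independent words; directedness puts both above one [w], and
    the clause for [le w] applies. *)
Lemma readable_read_at D k : subgraph D -> V D k -> readable (read_at D k).
Proof.
  intros HD Hk. split.
  - exists [], k. split; [split; auto | apply le_nil].
  - intros u v (w & h & Hw & H). exists w, h. eauto using le_prefix.
  - intros u u' v H1 H2 HG H3.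
    destruct (read_at_directed D k u' (u ++ v) HD H2 H3) as (w & h & Hw & K1 & K2).
    exists w, h. split; auto. eauto using le_replace, le_prefix.
  - intros u u' j H1 H2 HG.
    destruct (read_at_directed D k u u' HD H1 H2) as (w & h & Hw & K1 & K2).
    exists w, h. split; auto. eauto using le_jump.
  - intros u v (w & h & Hw & H). exists w, h. auto using le_winv.
  - intros u v Huv (w & h & Hw & H). exists w, h. eauto using le_R.
Qed.

(** Taking all base vertices avoids choosing one; on a connected graph they all contribute the same
    graph, by [clos_eq]. *)
Definition clos (D : graph) : graph :=
  (fun v => exists k, V D k /\ V (read_graph k (read_at D k)) v,
   fun e => exists k, V D k /\ E (read_graph k (read_at D k)) e).

(** If [p] labels a path from [k] to [k'], prefixing [p] turns words readable at [k'] into words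
    readable at [k] with the same end vertex. *)
Lemma clos_eq D k : tconnected D -> V D k -> clos D = read_graph k (read_at D k).
Proof.
  intros (HD & _ & HC) Hk.
  apply sameg_eq; [|split; intros z Hz; exists k; auto].
  split.
  - intros v (k' & Hk' & u & (w & h & Hw & Hu) & ->).
    destruct (HC _ _ Hk Hk') as [p Hp]. exists (p ++ u). split.
    + exists (p ++ w), h. split; [apply tpath_cat with k'; auto | apply le_prefix_app; auto].
    + rewrite (tpath_end _ _ _ _ Hp), wG_app. gnorm.
  - intros [v a] (k' & Hk' & u & (w & h & Hw & Hu) & Hv). cbn in Hv; subst v.
    destruct (HC _ _ Hk Hk') as [p Hp]. exists (p ++ u). cbn. split.
    + exists (p ++ w), h. split; [apply tpath_cat with k'; auto|].
      rewrite <- app_assoc. apply le_prefix_app; auto.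
    + rewrite (tpath_end _ _ _ _ Hp), wG_app. gnorm.
Qed.

(** The word [w w^-] labels a loop at [k]. In a closed graph so does the equivalent word
    [w w^- u u^-], and its factor [u] is read from [k]. *)
Lemma closed_le D k w h u : subgraph D -> tclosed R D -> tpath D k w h -> le w u ->
  tpath D k u (k ** wG u).
Proof.
  intros HD HC Hw Hu.
  assert (Hk : V D k) by exact (tpath_src _ _ _ _ HD Hw).
  assert (H : tpath D k (w ++ w^- ++ u ++ u^-) k).
  { apply (HC _ _ Hu k k Hk Hk). apply tpath_cat with h; auto. apply tpath_inv; auto. }
  rewrite !tpath_app in H by auto. destruct H as (_ & _ & H & _).
  replace (k ** wG w ** wG (w^-)) with k in H by (rewrite wG_inv; gnorm).
  exact H.
Qed.

Lemma clos_represents : represents X G tconnected clos (tclosed R).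
Proof.
  intros D HD. assert (HD' := HD). destruct HD' as (HS & (k & Hk) & HC).
  pose proof (readable_read_at D k HS Hk) as HQ.
  rewrite (clos_eq D k HD Hk).
  split; [|split; [|split]].
  - apply tconnected_read; auto.
  - apply tclosed_read; auto.
  - rewrite <- (clos_eq D k HD Hk). split.
    + intros v Hv. exists v. split; auto. apply read_graph_root.
      apply readable_read_at; auto.
    + intros [v a] Hv. destruct (HS _ Hv) as (H1 & H2 & _). exists v. split; auto.
      exists []. cbn. rewrite gmul1r. split; auto.
      exists [inl a], (v ** lab a). split; [split; [exact Hv | split; auto] | apply le_refl].
  - intros D' (HS' & _ & _) HC' Hsub. split.
    + intros v (u & (w & h & Hw & Hu) & ->).
      apply (tpath_tgt D' k u). eapply closed_le; eauto using tpath_mono.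
    + intros [v a] (u & (w & h & Hw & Hu) & Hv). cbn in Hv; subst v.
      assert (H : tpath D' k (u ++ [inl a]) (k ** wG (u ++ [inl a])))
        by (eapply closed_le; eauto using tpath_mono).
      apply tpath_app in H; auto. apply H.
Qed.

(** Each vertex or edge of the closure is due to a single word [w] labelling a path in [D], and the
    span of [w] is a finite connected subgraph of [D]. *)
Lemma clos_finitary : finitary X G tconnected clos.
Proof.
  intros D HD. pose proof (represents_closure _ _ _ clos_represents) as (_ & _ & Hm & _).
  split.
  - intro v. split.
    + intros (k & Hk & u & (w & h & Hw & Hu) & ->).
      exists (span k w). split; [apply tconnected_span|split; [apply finite_span|]].
      split; [apply (span_sub D k w h); auto; apply HD|].
      exists k. split; [apply span_src|]. exists u. split; auto.
      exists w, (k ** wG w). split; auto. apply tpath_span.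
    + intros (F & HF & _ & Hs & Hv). apply (proj1 (Hm F D HF HD Hs)); auto.
  - intro e. split.
    + intros (k & Hk & u & (w & h & Hw & Hu) & He).
      exists (span k w). split; [apply tconnected_span|split; [apply finite_span|]].
      split; [apply (span_sub D k w h); auto; apply HD|].
      exists k. split; [apply span_src|]. exists u. split; auto.
      exists w, (k ** wG w). split; auto. apply tpath_span.
    + intros (F & HF & _ & Hs & Hv). apply (proj2 (Hm F D HF HD Hs)); auto.
Qed.

Lemma clos_GF_closure : GF_closure X G tconnected clos.
Proof.
  split; [|split].
  - eapply represents_closure, clos_represents.
  - eapply represents_invariant, clos_represents.
  - apply clos_finitary.
Qed.

(** The graph read by [le u] from 1 is closed and contains the span of [u], hence also its closure.
    Thus the order of idempotents can be recovered from the closure operator. *)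
Lemma represents_span_le c u v : represents X G tconnected c (tclosed R) ->
  tpath (c (span (gone G) u)) (gone G) v (wG v) -> le u v.
Proof.
  intros Hc H.
  destruct (Hc _ (tconnected_span (gone G) u)) as (_ & _ & _ & Hm).
  pose proof (readable_le u) as HQ.
  assert (K : sub (c (span (gone G) u)) (read_graph (gone G) (le u))).
  { apply Hm; auto using tconnected_read, tclosed_read.
    apply span_sub with (gone G ** wG u); auto using subgraph_read.
    apply tpath_read1; auto using le_refl. }
  apply (tpath_mono _ _ _ _ _ K) in H. apply tpath_read1 in H; auto. apply H.
Qed.

End Congruence.

(** A coarser congruence has fewer closed graphs, hence larger closures. Conversely, if [R u v],
    then in [R'] each of [u u^-] and [v v^-] lies below the other; they commute, so they agree, and
    [R_related_eq] applies. *)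
Lemma congruence_closure_le R R' c c' : congruence R -> congruence R' ->
  represents X G tconnected c (tclosed R) -> represents X G tconnected c' (tclosed R') ->
  (forall u v, R u v -> R' u v) <-> (forall D, tconnected D -> sub (c D) (c' D)).
Proof.
  intros HR HR' Hc Hc'. split.
  - intros H D HD. destruct (Hc D HD) as (_ & _ & _ & Hm).
    destruct (Hc' D HD) as (H1 & H2 & H3 & _). apply Hm; auto.
    intros u v Huv. apply H2. auto.
  - intros H.
    assert (Hle : forall u v, R u v -> le R' u v).
    { intros u v Huv. apply (represents_span_le R' HR' c'); auto.
      apply (tpath_mono (c (span (gone G) u))); [apply H, tconnected_span|].
      destruct (Hc _ (tconnected_span (gone G) u)) as (_ & H2 & [H3 _] & _).
      apply (H2 u v Huv).
      - apply H3, span_src.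
      - apply H3. rewrite <- (cong_wG R HR _ _ Huv). apply span_tgt1.
      - rewrite <- (cong_wG R HR _ _ Huv). rewrite <- (gmul1l G (wG u)).
        apply span_tpath. apply Hc. apply tconnected_span. }
    intros u v Huv. pose proof (cong_equiv R HR) as Eq. pose proof (cong_equiv R' HR') as Eq'.
    assert (H1 := Hle _ _ Huv). assert (H2 := Hle _ _ (symmetry Huv)). unfold le in H1, H2.
    apply (R_related_eq R' HR'); [|exact (cong_wG R HR _ _ Huv)].
    transitivity (u ++ winv u ++ v ++ winv v); [symmetry; exact H1|].
    etransitivity; [apply (cong_comm R' HR') | exact H2].
Qed.

(** * Monoids as congruences on words *)

Section Object.
Variables (S : imdata) (i : X -> icar S) (mv : J -> icar S).

Definition tS (a : tok) : icar S :=
  match a with inl l => letS X S i l | inr j => mv j end.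

Fixpoint evA (w : list tok) : icar S :=
  match w with [] => ione S | a :: w' => imul S (tS a) (evA w') end.

(** The last clause makes the formal inverse [winv] evaluate to the inverse in [S]. *)
Record valued : Prop := {
  val_im : is_inverse_monoid S;
  val_gen : forall x, idom S (i x);
  val_mv : forall j, idom S (mv j);
  val_mv_inv : forall j, mv (jinv j) = iinv S (mv j) }.

Section Evaluation.
Hypothesis HV : valued.
Let IM := val_im HV.
Let Hgen := val_gen HV.
Let Hmv := val_mv HV.
Local Notation D := (idom S).
#[local] Hint Resolve IM Hgen Hmv im_1 im_M im_V : core.

Lemma tS_dom a : D (tS a).
Proof. destruct a as [[x|x]|j]; cbn; auto. Qed.
#[local] Hint Resolve tS_dom : core.

Lemma evA_dom w : D (evA w).
Proof. induction w as [|a w IH]; cbn; auto. Qed.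
#[local] Hint Resolve evA_dom : core.

Lemma evA_app u v : evA (u ++ v) = imul S (evA u) (evA v).
Proof.
  induction u as [|a u IH]; cbn.
  - rewrite im_mul1l; auto.
  - rewrite IH, im_mulA; auto.
Qed.

Lemma tS_inv a : tS (tinv a) = iinv S (tS a).
Proof.
  destruct a as [[x|x]|j]; cbn; [reflexivity | | apply (val_mv_inv HV)].
  rewrite im_invK; auto.
Qed.

Lemma evA_winv u : evA (winv u) = iinv S (evA u).
Proof.
  induction u as [|a u IH].
  - symmetry. apply im_inv1; auto.
  - change (a :: u) with ([a] ++ u). rewrite winv_app, !evA_app, IH, im_invM; auto.
    cbn. rewrite tS_inv, !im_mul1r; auto.
Qed.

Lemma evA_one a : evA [a] = tS a.
Proof. cbn. apply im_mul1r; auto. Qed.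

Lemma evA_induction (P : icar S -> Prop) :
  (forall a, P (tS a)) -> P (ione S) ->
  (forall a b, P a -> P b -> P (imul S a b)) -> forall w, P (evA w).
Proof. intros H1 H2 H3 w. induction w; cbn; auto. Qed.

End Evaluation.

(** The form shared by both kinds of objects: the operation m enters only through its values [mv] on
    jumps, and generation becomes surjectivity of the evaluation of words. *)
Record object (phi : icar S -> G) : Prop := {
  obj_val : valued;
  obj_E_unitary : E_unitary S;
  obj_surj : forall s, idom S s -> exists w, evA w = s;
  obj_phiM : forall a b, idom S a -> idom S b -> phi (imul S a b) = phi a ** phi b;
  obj_phi1 : phi (ione S) = gone G;
  obj_phiV : forall a, idom S a -> phi (iinv S a) = ginv G (phi a);
  obj_phi_gen : forall x, phi (i x) = iG x;
  obj_phi_sigma : forall s t, idom S s -> idom S t -> (phi s = phi t <-> sigma_rel S s t);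
  obj_phi_mv : forall j, phi (mv j) = jG j;
  obj_max : forall s j, idom S s -> phi s = jG j -> nat_le S s (mv j) }.

Section ObjectLemmas.
Variable phi : icar S -> G.
Hypothesis HS : object phi.
Let HV := obj_val phi HS.
Let IM := val_im HV.
Let Hgen := val_gen HV.
Let Hmv := val_mv HV.
Local Notation D := (idom S).

#[local] Hint Resolve HV IM Hgen Hmv im_1 im_M im_V tS_dom evA_dom : core.

Lemma phi_evA u : phi (evA u) = wG u.
Proof.
  induction u as [|a u IH]; cbn.
  - apply (obj_phi1 phi HS).
  - rewrite (obj_phiM phi HS), IH by auto. f_equal. destruct a as [[x|x]|j]; cbn.
    + apply (obj_phi_gen phi HS).
    + rewrite (obj_phiV phi HS), (obj_phi_gen phi HS); eauto.
    + apply (obj_phi_mv phi HS).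
Qed.

Lemma object_congruence : congruence (fun u v => evA u = evA v).
Proof.
  split.
  - split; congruence.
  - intros. rewrite !(evA_app HV). congruence.
  - intros. rewrite !(evA_winv HV). congruence.
  - intros. rewrite !(evA_app HV), (evA_winv HV), im_regular; auto.
  - intros. rewrite !(evA_app HV), !(evA_winv HV), <- !(im_mulA S IM _ _ (imul S _ _)) by auto.
    apply im_comm; auto.
  - intros u v H. rewrite <- !phi_evA, H. reflexivity.
  (* A word with image 1 is sigma-related to 1 in [S], so its value lies above some idempotent [e],
     and E-unitarity makes it idempotent. *)
  - intros u Hu. rewrite (evA_app HV).
    assert (K : phi (evA u) = phi (ione S))
      by (rewrite phi_evA, (obj_phi1 phi HS); auto).
    apply (obj_phi_sigma phi HS) in K; auto. destruct K as (e & He & Hee).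
    apply (obj_E_unitary phi HS e (evA u)); auto.
    exists e. split; auto. rewrite Hee, im_mul1r; auto. apply He.
  - intros u j Hu. rewrite !(evA_app HV), (evA_winv HV). cbn.
    rewrite (im_mul1r S IM (mv j)) by eauto.
    apply nat_le_absorb; eauto. apply (obj_max phi HS); auto. rewrite phi_evA; auto.
Qed.

End ObjectLemmas.
End Object.

Lemma evA_map_inl S i mv w : evA S i mv (map inl w) = evalS X S i w.
Proof. induction w as [|a w IH]; cbn; [|rewrite IH]; reflexivity. Qed.

Lemma wG_map_inl w : wG (map inl w) = evalG X G iG w.
Proof. induction w as [|a w IH]; cbn; [|rewrite IH]; reflexivity. Qed.

Lemma tpath_map_inl D g w h : tpath D g (map inl w) h <-> lpath X G iG D g w h.
Proof.
  revert g; induction w as [|a w IH]; intro g; cbn; [tauto|]. rewrite IH. tauto.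
Qed.

Lemma winv_map_inl w : winv (map inl w) = map inl (rev (map linv w)).
Proof. unfold winv. rewrite !map_rev, !map_map. reflexivity. Qed.

Lemma canon_morph_evA S iS mS T iT mT f w : valued S iS mS ->
  canon_im_morph X S iS T iT f -> (forall j, f (mS j) = mT j) ->
  idom S (evA S iS mS w) /\ f (evA S iS mS w) = evA T iT mT w.
Proof.
  intros [HS Hi Hm _] (_ & fM & f1 & fV & fi) fm.
  assert (Ht : forall a, idom S (tS S iS mS a) /\ f (tS S iS mS a) = tS T iT mT a).
  { intros [[x|x]|j]; cbn; auto. split; [apply HS; auto|].
    rewrite fV, fi; auto. }
  induction w as [|a w [D1 IH]]; cbn; [split; [apply HS | auto]|].
  destruct (Ht a) as [D2 E2]. split; [apply HS; auto|]. rewrite fM; congruence.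
Qed.

Lemma canon_morph_iff S iS mS phiS T iT mT phiT :
  object S iS mS phiS -> object T iT mT phiT ->
  (exists f, canon_im_morph X S iS T iT f /\ forall j, f (mS j) = mT j) <->
  (forall u v, evA S iS mS u = evA S iS mS v -> evA T iT mT u = evA T iT mT v).
Proof.
  intros HS HT. split.
  - intros (f & Hf & Hm) u v H.
    pose proof (fun w => canon_morph_evA S iS mS T iT mT f w (obj_val _ _ _ _ HS) Hf Hm) as K.
    rewrite <- (proj2 (K u)), <- (proj2 (K v)), H. reflexivity.
  - intro H.
    (* A morphism has to send the value of a word in [S] to its value in [T]; epsilon chooses such a
       word. On elements that are not values of words the choice is arbitrary. *)
    set (f := fun s => epsilon (inhabits (ione T))
      (fun t => exists u, evA S iS mS u = s /\ evA T iT mT u = t)).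
    assert (Hf : forall u, f (evA S iS mS u) = evA T iT mT u).
    { intro u. unfold f.
      assert (K : exists t, exists v, evA S iS mS v = evA S iS mS u /\ evA T iT mT v = t)
        by eauto.
      apply (epsilon_spec (inhabits (ione T))) in K. destruct K as (v & H1 & H2).
      rewrite <- H2. apply H; auto. }
    assert (Ht : forall a, f (tS S iS mS a) = tS T iT mT a).
    { intro a. pose proof (Hf [a]) as K.
      rewrite (evA_one _ _ _ (obj_val _ _ _ _ HS)), (evA_one _ _ _ (obj_val _ _ _ _ HT)) in K.
      exact K. }
    exists f. split; [|intro j; exact (Ht (inr j))].
    split; [|split; [|split; [|split]]].
    + intros s Hs. destruct (obj_surj _ _ _ _ HS s Hs) as [u <-].
      rewrite Hf. apply evA_dom, (obj_val _ _ _ _ HT).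
    + intros a b Ha Hb. destruct (obj_surj _ _ _ _ HS a Ha) as [u <-].
      destruct (obj_surj _ _ _ _ HS b Hb) as [v <-].
      rewrite <- (evA_app _ _ _ (obj_val _ _ _ _ HS)), !Hf. apply (evA_app _ _ _ (obj_val _ _ _ _ HT)).
    + exact (Hf []).
    + intros a Ha. destruct (obj_surj _ _ _ _ HS a Ha) as [u <-].
      rewrite <- (evA_winv _ _ _ (obj_val _ _ _ _ HS)), !Hf. apply (evA_winv _ _ _ (obj_val _ _ _ _ HT)).
    + intro x. exact (Ht (inl (inl x))).
Qed.

(** * The monoid of a closure operator *)

Section ClosureMonoid.
Variable c : graph -> graph.
Hypothesis Hc : GF_closure X G tconnected c.

Local Notation "1" := (gone G).
Local Notation Sc := (Sc X G tconnected c).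
Local Notation gen := (Sc_gen X G iG tconnected c).

Lemma c_tconnected D : tconnected D -> tconnected (c D).
Proof. apply Hc. Qed.

Lemma c_ext D : tconnected D -> sub D (c D).
Proof. apply Hc. Qed.

Lemma c_mono D D' : tconnected D -> tconnected D' -> sub D D' -> sub (c D) (c D').
Proof. apply Hc. Qed.

Lemma c_idem D : tconnected D -> c (c D) = c D.
Proof. intro H. apply sameg_eq; apply Hc; auto. Qed.

Lemma c_translate g D : tconnected D -> c (translate g D) = translate g (c D).
Proof. intro H. apply sameg_eq; apply Hc; auto. Qed.

Lemma c_between D D' : tconnected D -> tconnected D' -> sub D D' -> sub D' (c D) ->
  c D' = c D.
Proof.
  intros H H' H1 H2. apply sameg_eq; [|apply c_mono; auto].
  rewrite <- (c_idem D) by auto. apply c_mono; auto using c_tconnected.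
Qed.

Lemma c_union D D' k : tconnected D -> tconnected D' -> V D k -> V D' k ->
  c (gunion (c D) (c D')) = c (gunion D D').
Proof.
  intros H H' Hk Hk'.
  assert (HU : tconnected (gunion D D')) by eauto using tconnected_union.
  apply c_between; auto.
  - apply tconnected_union with k; auto using c_tconnected; apply c_ext; auto.
  - apply sub_union; (eapply subg_trans; [apply c_ext; auto|]);
      [apply sub_unionl | apply sub_unionr].
  - apply sub_union; apply c_mono; auto using sub_unionl, sub_unionr.
Qed.

(** The value of a word in [Sc]. All elements have this form, and products and inverses are computed
    on words, so identities of [Sc] reduce to equalities of spans. *)
Definition cs (w : list tok) : icar Sc := (c (span 1 w), wG w).

Lemma Sc_mul u v : imul Sc (cs u) (cs v) = cs (u ++ v).
Proof.
  unfold cs. cbn. rewrite wG_app. f_equal.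
  rewrite <- c_translate by apply tconnected_span.
  rewrite translate_span, span_app, gmul1l, gmul1r.
  apply c_union with (wG u); auto using tconnected_span, span_src, span_tgt1.
Qed.

Lemma Sc_inv u : iinv Sc (cs u) = cs (winv u).
Proof.
  unfold cs. cbn. rewrite wG_inv. f_equal.
  rewrite <- c_translate by apply tconnected_span.
  rewrite translate_span, gmul1r, <- (span_inv (ginv G (wG u))), gmulVl. reflexivity.
Qed.

Lemma cs_eq u v : span 1 u = span 1 v -> wG u = wG v -> cs u = cs v.
Proof. unfold cs. intros -> ->. reflexivity. Qed.

Lemma Sc_gen_cs x : gen x = cs [inl (inl x)].
Proof.
  unfold cs, Sc_gen. cbn. rewrite gmul1r, gmul1l. f_equal. f_equal.
  apply sameg_eq; split; cbn; rewrite ?gmul1l; tauto.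
Qed.

Definition Sc_jump (j : J) : icar Sc := (c (pair_graph X G 1 (jG j)), jG j).

Lemma Sc_jump_cs j : Sc_jump j = cs [inr j].
Proof.
  unfold cs, Sc_jump. cbn. rewrite gmul1r, gmul1l. f_equal. f_equal.
  apply sameg_eq; split; cbn; tauto.
Qed.

Lemma evA_Sc w : evA Sc gen Sc_jump w = cs w.
Proof.
  induction w as [|a w IH]; [reflexivity|].
  change (a :: w) with ([a] ++ w). rewrite <- Sc_mul, <- IH. cbn [evA app]. f_equal.
  destruct a as [[x|x]|j]; cbn [tS letS].
  - apply Sc_gen_cs.
  - rewrite Sc_gen_cs, Sc_inv. reflexivity.
  - apply Sc_jump_cs.
Qed.

Lemma cs_dom w : idom Sc (cs w).
Proof.
  assert (H : sub (span 1 w) (c (span 1 w))) by (apply c_ext, tconnected_span).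
  split; [|split].
  - exists (span 1 w). auto using tconnected_span, finite_span.
  - apply H, span_src.
  - apply H, span_tgt1.
Qed.

Lemma Sc_dom_cs p : idom Sc p -> exists w, p = cs w.
Proof.
  destruct p as [D g]. intros ((F & HF & Hfin & HD) & H1 & Hg). cbn in HD, H1, Hg. subst D.
  pose proof (c_tconnected F HF) as HcF.
  (* The vertex 1 lies in [c F] but perhaps not in [F], so the loop covering [F] runs in [c F]; its
     span lies between the two and has the same closure. *)
  destruct (covering_loop (c F) F 1 HcF H1 Hfin (c_ext F HF)) as (u & Hu & HFu).
  assert (HcF' := HcF). destruct HcF' as (HS & _ & HC).
  destruct (HC _ _ H1 Hg) as [q Hq].
  exists (u ++ q). unfold cs.
  assert (Huq : tpath (c F) 1 (u ++ q) g) by (apply tpath_cat with 1; auto).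
  f_equal.
  - symmetry. apply c_between; auto using tconnected_span.
    + rewrite span_app. eapply subg_trans; [exact HFu | apply sub_unionl].
    + eapply span_sub; eauto.
  - rewrite (tpath_end _ _ _ _ Huq). apply gmul1l.
Qed.

(** The loop [u (winv u)] adds its graph and returns to [g], so multiplying by an idempotent means
    taking a union. *)
Lemma span_idem_app g u t : span g (u ++ winv u ++ t) = gunion (span g u) (span g t).
Proof.
  rewrite !span_app, span_inv, wG_inv.
  replace (g ** wG u ** ginv G (wG u)) with g by gnorm.
  apply sameg_eq; split; cbn; tauto.
Qed.

Lemma Sc_idem_snd e : idem Sc e -> snd e = 1.
Proof.
  intros [_ He]. apply (f_equal snd) in He. cbn in He.
  apply (gmul_injl G (snd e)). rewrite He, gmul1r. reflexivity.
Qed.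

Lemma cs_idem u : wG u = 1 -> idem Sc (cs u).
Proof.
  intro Hu. split; [apply cs_dom|]. rewrite Sc_mul. apply cs_eq.
  - rewrite span_app, Hu, gmul1l. apply sameg_eq; split; cbn; tauto.
  - rewrite wG_app, Hu. apply gmul1l.
Qed.

Lemma Sc_inverse_monoid : is_inverse_monoid Sc.
Proof.
  assert (one : ione Sc = cs []) by reflexivity.
  split; [rewrite one; apply cs_dom|].
  split; [|split; [|split; [|split; [|split; [|split; [|split]]]]]].
  - intros a b Ha Hb. apply Sc_dom_cs in Ha, Hb. destruct Ha as [u ->], Hb as [v ->].
    rewrite Sc_mul. apply cs_dom.
  - intros a Ha. apply Sc_dom_cs in Ha. destruct Ha as [u ->].
    rewrite Sc_inv. apply cs_dom.
  - intros a b d Ha Hb Hd. apply Sc_dom_cs in Ha, Hb, Hd.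
    destruct Ha as [u ->], Hb as [v ->], Hd as [w ->].
    rewrite !Sc_mul, app_assoc. reflexivity.
  - intros a Ha. apply Sc_dom_cs in Ha. destruct Ha as [u ->].
    rewrite one, !Sc_mul, app_nil_r. auto.
  - intros a Ha. apply Sc_dom_cs in Ha. destruct Ha as [u ->].
    rewrite !Sc_inv, winvK. reflexivity.
  - intros a b Ha Hb. apply Sc_dom_cs in Ha, Hb. destruct Ha as [u ->], Hb as [v ->].
    rewrite !Sc_mul, !Sc_inv, Sc_mul, winv_app. reflexivity.
  - intros a Ha. apply Sc_dom_cs in Ha. destruct Ha as [u ->].
    rewrite Sc_inv, !Sc_mul, <- app_assoc. apply cs_eq.
    + rewrite span_idem_app. apply sameg_eq; split; cbn; tauto.
    + rewrite !wG_app, wG_inv. gnorm.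
  - intros a b Ha Hb. apply Sc_dom_cs in Ha, Hb. destruct Ha as [u ->], Hb as [v ->].
    rewrite !Sc_inv, !Sc_mul, <- !app_assoc. apply cs_eq.
    (* Appending the empty word brings the trailing inverses into the shape of [span_idem_app]; the
       extra vertex 1 already lies in both spans. *)
    + rewrite !span_idem_app, <- (app_nil_r (winv v)), <- (app_nil_r (winv u)), !span_idem_app.
      pose proof (span_src 1 u). pose proof (span_src 1 v).
      apply sameg_eq; split; cbn; intuition congruence.
    + rewrite !wG_app, !wG_inv. gnorm.
Qed.

(** Idempotents are the elements with second component 1, and multiplying by an idempotent preserves
    the second component. *)
Lemma Sc_E_unitary : E_unitary Sc.
Proof.
  intros e s He Hs (f & Hf & ->). apply Sc_idem_snd in He, Hf.
  apply Sc_dom_cs in Hs. destruct Hs as [u ->]. apply cs_idem.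
  cbn in He. rewrite Hf, gmul1l in He. exact He.
Qed.

Lemma Sc_sigma s t : idom Sc s -> idom Sc t -> (snd s = snd t <-> sigma_rel Sc s t).
Proof.
  intros Hs Ht. split.
  - apply Sc_dom_cs in Hs, Ht. destruct Hs as [u ->], Ht as [v ->]. cbn. intro Huv.
    (* Multiplied by this idempotent, both elements acquire the union of the two spans as their
       graph before closure. *)
    exists (cs (u ++ winv u ++ v ++ winv v)). split.
    + apply cs_idem. rewrite !wG_app, !wG_inv. gnorm.
    + rewrite !Sc_mul, <- !app_assoc. apply cs_eq.
      * rewrite !span_idem_app. apply sameg_eq; split; cbn; tauto.
      * rewrite !wG_app, Huv. reflexivity.
  - intros (e & He & H). apply (f_equal snd) in H. cbn in H.
    apply gmul_injl in H. exact H.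
Qed.

Lemma Sc_max s j : idom Sc s -> snd s = jG j -> nat_le Sc s (Sc_jump j).
Proof.
  intros Hs Hj. apply Sc_dom_cs in Hs. destruct Hs as [u ->]. cbn in Hj.
  (* The jump adds to the span of [u] only the vertices 1 and [jG j = wG u], which it already
     contains. *)
  exists (cs (u ++ winv u)). split.
  - apply cs_idem. rewrite wG_app, wG_inv. gnorm.
  - rewrite Sc_jump_cs, Sc_mul, <- app_assoc. apply cs_eq.
    + rewrite span_idem_app. apply sameg_eq; [apply sub_unionl|].
      apply sub_union; [apply subg_refl|].
      apply span_sub with (jG j); [apply subgraph_span|]. cbn.
      rewrite gmul1l, <- Hj. split; [apply span_src|]. split; auto.
      apply span_tgt1.
    + rewrite !wG_app, wG_inv. cbn. rewrite Hj. gnorm.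
Qed.

Lemma Sc_valued : valued Sc gen Sc_jump.
Proof.
  split; auto using Sc_inverse_monoid.
  - intro x. rewrite Sc_gen_cs. apply cs_dom.
  - intro x. rewrite Sc_jump_cs. apply cs_dom.
  - intro x. rewrite !Sc_jump_cs, Sc_inv. reflexivity.
Qed.

Lemma Sc_object : object Sc gen Sc_jump snd.
Proof.
  split; try reflexivity; auto using Sc_valued, Sc_E_unitary, Sc_sigma, Sc_max.
  intros s Hs. apply Sc_dom_cs in Hs. destruct Hs as [w ->]. exists w. apply evA_Sc.
Qed.

(** As [c D] is closed, it contains a span exactly when it contains the closure of that span. Hence
    the paths of [c D] labelled by [u] depend only on [cs u]. *)
Lemma tpath_c g u h D : tconnected D ->
  tpath (c D) g u h <-> sub (translate g (c (span 1 u))) (c D) /\ h = g ** wG u.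
Proof.
  intro HD. pose proof (c_tconnected D HD) as HcD.
  rewrite <- c_translate, translate_span, gmul1r by apply tconnected_span.
  split.
  - intro H. split; [|eapply tpath_end; eauto].
    rewrite <- (c_idem D) by auto. apply c_mono; auto using tconnected_span.
    eapply span_sub; [apply HcD | eauto].
  - intros [H ->]. apply span_tpath. eapply subg_trans; [|exact H].
    apply c_ext, tconnected_span.
Qed.

(** By [tpath_c], words equal in [Sc] label the same paths in [c D]. For minimality, finitarity
    reduces to finite [F]: a loop [u] with span [F] absorbs any path [w] of [c F], so [u w w^-]
    equals [u] in [Sc], and a closed graph containing [F] must carry [w]. *)
Lemma Sc_represents :
  represents X G tconnected c (tclosed (fun u v => evA Sc gen Sc_jump u = evA Sc gen Sc_jump v)).
Proof.
  intros D HD. split; [|split; [|split]]; auto using c_tconnected, c_ext.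
  - intros u v Huv g h _ _. rewrite !evA_Sc in Huv. injection Huv as H1 H2.
    rewrite !tpath_c, H1, H2 by auto. tauto.
  - intros D' HD' HC Hsub.
    assert (Hpath : forall F k w h, tconnected F -> finite_graph X G F -> sub F D ->
      V F k -> tpath (c F) k w h -> tpath D' k w h).
    { intros F k w h HF Hfin HFD Hk Hw.
      destruct (covering_loop F F k HF Hk Hfin (subg_refl X G F)) as (u & Hu & HFu).
      pose proof (tpath_end _ _ _ _ Hu) as HuG.
      assert (Hu1 : wG u = 1) by (apply (gmul_injl G k); rewrite gmul1r; auto).
      assert (HFD' : sub F D') by eauto using subg_trans.
      assert (Hk' : V D' k) by (apply HFD'; auto).
      pose proof (c_tconnected F HF) as HcF. assert (HSc := proj1 HcF).
      assert (HS' := proj1 HD').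
      assert (E0 : span k u = F).
      { apply sameg_eq; auto. eapply span_sub; [apply HF | eauto]. }
      assert (E1 : c (span k (u ++ w ++ winv w)) = c (span k u)).
      { apply c_between; auto using tconnected_span.
        - rewrite span_app. apply sub_unionl.
        - rewrite E0. apply span_sub with k; auto.
          apply tpath_cat with k; [auto | eapply tpath_mono; [apply c_ext; auto | eauto] |].
          apply tpath_cat with h; auto. apply tpath_inv; auto. }
      assert (E2 : cs (u ++ w ++ winv w) = cs u).
      { unfold cs. f_equal.
        (* [E1] compares closures of spans based at [k]; by invariance these are [k]-translates of
           closures based at 1, and translation can be undone. *)
        - rewrite <- (gmul1r G k) in E1.
          rewrite <- !translate_span, !c_translate in E1 by apply tconnected_span.
          rewrite <- (translateVK k (c (span 1 u))), <- E1, translateVK. reflexivity.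
        - rewrite !wG_app, wG_inv. gnorm. }
      assert (K : tpath D' k (u ++ w ++ winv w) k).
      { assert (E3 : evA Sc gen Sc_jump (u ++ w ++ winv w) = evA Sc gen Sc_jump u)
          by (rewrite !evA_Sc; exact E2).
        apply (HC _ _ E3 k k Hk' Hk').
        eapply tpath_mono; [exact HFD' | exact Hu]. }
      apply tpath_app in K; auto. rewrite Hu1, gmul1r in K.
      destruct K as [_ K]. apply tpath_app in K; auto.
      rewrite (tpath_end _ _ _ _ Hw). apply K. }
    destruct Hc as (_ & _ & Hfin). destruct (Hfin D HD) as [HV HE]. split.
    + intros v Hv. apply HV in Hv. destruct Hv as (F & HF & HFf & HFD & Hv).
      assert (HF' := HF). destruct HF' as (_ & (k & Hk) & _).
      destruct (c_tconnected F HF) as (_ & _ & HCF).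
      destruct (HCF k v) as [w Hw]; auto; [apply c_ext; auto|].
      apply (tpath_tgt D' k w). eapply Hpath; eauto.
    + intros [v a] Hv. apply HE in Hv. destruct Hv as (F & HF & HFf & HFD & Hv).
      assert (HF' := HF). destruct HF' as (_ & (k & Hk) & _).
      destruct (c_tconnected F HF) as (HSF & _ & HCF).
      destruct (HSF _ Hv) as (Hv1 & Hv2 & _).
      destruct (HCF k v) as [w Hw]; auto; [apply c_ext; auto|].
      assert (K : tpath D' k (w ++ [inl a]) (v ** lab a)).
      { eapply Hpath; eauto. apply tpath_cat with v; auto.
        split; [exact Hv | split; auto]. }
      apply tpath_app in K; [|apply HD']. destruct K as [_ [K _]].
      rewrite <- (tpath_end _ _ _ _ Hw) in K. exact K.
Qed.

End ClosureMonoid.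

(** * Morphisms of objects and inclusions of closure operators *)

Lemma object_morph_iff S iS mS phiS T iT mT phiT cS cT :
  object S iS mS phiS -> object T iT mT phiT ->
  represents X G tconnected cS (tclosed (fun u v => evA S iS mS u = evA S iS mS v)) ->
  represents X G tconnected cT (tclosed (fun u v => evA T iT mT u = evA T iT mT v)) ->
  (exists f, canon_im_morph X S iS T iT f /\ forall j, f (mS j) = mT j) <->
  (forall D, tconnected D -> sub (cS D) (cT D)).
Proof.
  intros HS HT HcS HcT. rewrite (canon_morph_iff _ _ _ _ _ _ _ _ HS HT).
  apply (congruence_closure_le _ _ _ _ (object_congruence _ _ _ _ HS)
    (object_congruence _ _ _ _ HT) HcS HcT).
Qed.

Lemma object_closure_monoid S i mv phi : object S i mv phi ->
  exists c, GF_closure X G tconnected c /\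
    represents X G tconnected c (tclosed (fun u v => evA S i mv u = evA S i mv v)) /\
    exists f, canon_im_morph X (Sc X G tconnected c) (Sc_gen X G iG tconnected c) S i f /\
      (forall j, f (Sc_jump c j) = mv j) /\
      (forall p, idom (Sc X G tconnected c) p -> phi (f p) = snd p) /\
      bijective_on (Sc X G tconnected c) S f.
Proof.
  intro HS. pose proof (object_congruence _ _ _ _ HS) as HR.
  set (R := fun u v => evA S i mv u = evA S i mv v) in *.
  exists (clos R). pose proof (clos_GF_closure R HR) as Hc.
  pose proof (clos_represents R HR) as Hrep.
  split; [auto | split; [auto|]].
  pose proof (Sc_object _ Hc) as HO. pose proof (Sc_represents _ Hc) as HOrep.
  assert (Hf : exists f, canon_im_morph X (Sc X G tconnected (clos R))
     (Sc_gen X G iG tconnected (clos R)) S i f /\ forall j, f (Sc_jump (clos R) j) = mv j).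
  { apply (object_morph_iff _ _ _ _ _ _ _ _ _ _ HO HS HOrep Hrep).
    intros; apply subg_refl. }
  (* The morphism from [S] back to [Sc] shows that words equal in [S] are equal in [Sc], which makes
     [f] injective. *)
  assert (Hg : forall u v, evA S i mv u = evA S i mv v -> cs (clos R) u = cs (clos R) v).
  { intros u v. rewrite <- !(evA_Sc _ Hc). revert u v.
    apply (canon_morph_iff _ _ _ _ _ _ _ _ HS HO).
    apply (object_morph_iff _ _ _ _ _ _ _ _ _ _ HS HO Hrep HOrep).
    intros; apply subg_refl. }
  destruct Hf as (f & Hf & Hm). exists f. split; [auto | split; [auto|]].
  assert (Hev : forall w, f (cs (clos R) w) = evA S i mv w).
  { intro w. rewrite <- (evA_Sc _ Hc).
    apply (canon_morph_evA _ _ _ _ _ _ _ _ (obj_val _ _ _ _ HO) Hf Hm). }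
  split; [|split].
  - intros p Hp. apply Sc_dom_cs in Hp; auto. destruct Hp as [w ->].
    rewrite Hev. apply (phi_evA _ _ _ _ HS).
  - intros s s' Hs Hs'. apply Sc_dom_cs in Hs, Hs'; auto.
    destruct Hs as [u ->], Hs' as [v ->]. rewrite !Hev. auto.
  - intros t Ht. destruct (obj_surj _ _ _ _ HS t Ht) as [w <-].
    exists (cs (clos R) w). split; [apply cs_dom; auto | auto].
Qed.

End Tokens.

Arguments obj_val {X G iG J jG jinv S i mv phi}.
Arguments obj_surj {X G iG J jG jinv S i mv phi}.
Arguments obj_phi_sigma {X G iG J jG jinv S i mv phi}.
Arguments obj_max {X G iG J jG jinv S i mv phi}.
Arguments phi_evA {X G iG J jG jinv S i mv phi}.
Arguments val_mv {X J jinv S i mv}.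
Arguments evA_one {X J jinv S i mv}.
Arguments evA_app {X J jinv S i mv}.
Arguments evA_winv {X J jinv S i mv}.
Arguments evA_dom {X J jinv S i mv}.
(** * The two instances *)

Section Words.
Variables (X : Type) (G : group) (iG : X -> G).
Local Notation graph := (graph X G).
Local Notation evalG := (evalG X G iG).

Definition word_inv (w : list (letter X)) : list (letter X) := rev (map (linv X) w).

Lemma word_invK w : word_inv (word_inv w) = w.
Proof.
  unfold word_inv. rewrite map_rev, rev_involutive, map_map.
  rewrite <- (map_id w) at 2. apply map_ext, linvK.
Qed.

(** * No jumps: E-unitary inverse monoids *)

Definition jG0 (j : Empty_set) : G := match j with end.
Definition mv0 (S : imdata) (j : Empty_set) : icar S := match j with end.

Local Notation tconnected0 := (tconnected X G iG Empty_set jG0).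
Local Notation object0 S i := (object X G iG Empty_set jG0 id S i (mv0 S)).
Local Notation tclosed0 S i := (tclosed X G iG Empty_set jG0
  (fun u v => evA X Empty_set S i (mv0 S) u = evA X Empty_set S i (mv0 S) v)).

(** Words of letters are token words without jumps, so the general fact about [winv] transfers. *)
Lemma evalG_word_inv w : evalG (word_inv w) = ginv G (evalG w).
Proof.
  rewrite <- !(wG_map_inl X G iG Empty_set jG0).
  unfold word_inv. rewrite <- (winv_map_inl X Empty_set id). apply wG_inv. intros [].
Qed.

Lemma evalG_app u v : evalG (u ++ v) = gmul G (evalG u) (evalG v).
Proof.
  rewrite <- !(wG_map_inl X G iG Empty_set jG0), map_app. apply wG_app.
Qed.

Lemma evalG_surj : group_generated X G iG -> forall g, exists w, evalG w = g.
Proof.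
  intros HG. apply HG.
  - intro x. exists [inl x]. cbn. apply gmul1r.
  - exists []. reflexivity.
  - intros a b [u <-] [v <-]. exists (u ++ v). apply evalG_app.
  - intros a [u <-]. exists (word_inv u). apply evalG_word_inv.
Qed.

Lemma valued0 S i : is_inverse_monoid S -> (forall x, idom S (i x)) ->
  valued X Empty_set id S i (mv0 S).
Proof. intros H1 H2. split; auto; intros []. Qed.

Lemma evalS_dom S i w : is_inverse_monoid S -> (forall x, idom S (i x)) ->
  idom S (evalS X S i w).
Proof.
  intros H1 H2. rewrite <- (evA_map_inl X Empty_set S i (mv0 S)).
  apply (evA_dom (jinv := id)), valued0; auto.
Qed.

Lemma evalS_word_inv S i w : is_inverse_monoid S -> (forall x, idom S (i x)) ->
  evalS X S i (word_inv w) = iinv S (evalS X S i w).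
Proof.
  intros H1 H2. rewrite <- !(evA_map_inl X Empty_set S i (mv0 S)).
  unfold word_inv. rewrite <- (winv_map_inl X Empty_set id). apply evA_winv, valued0; auto.
Qed.

Lemma tokens0 (w : list (tok X Empty_set)) : exists u, w = map inl u.
Proof.
  induction w as [|[a|[]] w [u ->]]; [exists [] | exists (a :: u)]; reflexivity.
Qed.

Lemma E_object_iff S i : E_object X G iG S i <-> exists phi, object0 S i phi.
Proof.
  split.
  - intros (IM & EU & (Hgen & Hind) & (phi & h1 & h2 & h3 & h4 & h5)). exists phi.
    pose proof (valued0 S i IM Hgen) as HV.
    split; auto; try intros [].
    + apply Hind.
      * intro x. exists [inl (inl x)]. apply (evA_one HV).
      * exists []. reflexivity.
      * intros a b [u <-] [v <-]. exists (u ++ v). apply (evA_app HV).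
      * intros a [u <-]. exists (winv X Empty_set id u). apply (evA_winv HV).
    + intros s [].
  - intros (phi & HO). destruct (obj_val HO) as [IM Hgen _ _].
    split; [auto | split; [apply HO | split; [split; [auto|]|]]].
    + intros P P1 P2 P3 P4 s Hs.
      destruct (obj_surj HO s Hs) as [w <-].
      apply evA_induction; auto. intros [[x|x]|[]]; cbn; auto.
    + exists phi. destruct HO. auto.
Qed.

Lemma PCSub_tconnected : PCSub X G iG = tconnected0.
Proof.
  apply functional_extensionality; intro D; apply propositional_extensionality.
  assert (H : forall g h,
    (exists w, tpath X G iG Empty_set jG0 D g w h) <-> exists w, lpath X G iG D g w h).
  { intros g h. split.
    - intros [w Hw]. destruct (tokens0 w) as [u ->]. exists u. apply tpath_map_inl in Hw. auto.
    - intros [w Hw]. exists (map inl w). apply tpath_map_inl. auto. }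
  unfold PCSub, PSub, tconnected, connected.
  split.
  - intros [[H1 H2] H3]. split; [auto | split; [auto|]]. intros. apply H; auto.
  - intros (H1 & H2 & H3). split; [auto|]. intros. apply H; auto.
Qed.

Lemma closed_E_tclosed S i : closed_E X G iG S i = tclosed0 S i.
Proof.
  apply functional_extensionality; intro D; apply propositional_extensionality.
  split.
  - intros H u v. destruct (tokens0 u) as [u' ->], (tokens0 v) as [v' ->].
    rewrite !evA_map_inl. intros Huv g h Hg Hh. rewrite !tpath_map_inl. auto.
  - intros H u v Huv g h Hg Hh. rewrite <- !(tpath_map_inl X G iG Empty_set jG0).
    apply H; auto. rewrite !evA_map_inl. auto.
Qed.

(** * Jumps labelled by words: F-inverse monoids *)

Local Notation W := (list (letter X)).
Local Notation tconnectedW := (tconnected X G iG W evalG).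
Local Notation mvW S m i := (fun v : W => m (evalS X S i v)).
Local Notation objectW S m i := (object X G iG W evalG word_inv S i (mvW S m i)).
Local Notation tclosedW S m i := (tclosed X G iG W evalG
  (fun u v => evA X W S i (mvW S m i) u = evA X W S i (mvW S m i) v)).

(** As [X] generates [G], any two vertices differ by the value of a word, and the jump with this
    label joins them. *)
Lemma PSub_tconnected : group_generated X G iG -> PSub X G iG = tconnectedW.
Proof.
  intro HG.
  apply functional_extensionality; intro D; apply propositional_extensionality.
  unfold PSub, tconnected. split; [intros [H1 H2] | tauto].
  split; [auto | split; [auto|]]. intros g h Hg Hh.
  destruct (evalG_surj HG (gmul G (ginv G g) h)) as [v Hv].
  exists [inr v]. cbn. rewrite Hv, gmul_Kinv. auto.
Qed.

Definition tokens_of_rest (r : list (W * W)) : list (tok X W) :=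
  flat_map (fun p => inr (fst p) :: map inl (snd p)) r.

Definition tokens_of_term (t : term X) : list (tok X W) :=
  map inl (fst t) ++ tokens_of_rest (snd t).

Lemma tokens_of_term_surj w : exists t, tokens_of_term t = w.
Proof.
  induction w as [|[a|v] w [[u r] <-]].
  - exists ([], []). reflexivity.
  - exists (a :: u, r). reflexivity.
  - exists ([], (v, u) :: r). reflexivity.
Qed.

(** Stated for a split term, so that after a jump the next factor takes the role of the initial
    word. *)
Lemma tpath_term D g u r h :
  tpath X G iG W evalG D g (map inl u ++ tokens_of_rest r) h <->
  journey X G iG D g (u, r) h.
Proof.
  unfold journey. cbn.
  revert g u; induction r as [|[v u'] r IH]; intros g u; revert g;
    induction u as [|a u IHu]; intro g; cbn.
  - split; [intros [H1 ->]; eauto | intros (g1 & [H1 <-] & H3); auto].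
  - rewrite IHu. split; [intros [H1 (g1 & H2 & H3)] | intros (g1 & [H1 H2] & H3)]; eauto.
  - rewrite IH. split; [intros [H1 H2] | intros (g1 & [H1 <-] & H3)]; eauto.
  - cbn in IHu. rewrite IHu.
    split; [intros [H1 (g1 & H2 & H3)] | intros (g1 & [H1 H2] & H3)]; eauto.
Qed.

Lemma evA_term S m i t : is_inverse_monoid S -> (forall x, idom S (i x)) ->
  (forall v, idom S (m (evalS X S i v))) ->
  evA X W S i (mvW S m i) (tokens_of_term t) = evalT X S i m t.
Proof.
  intros IM Hgen Hm. destruct t as [u r]. unfold tokens_of_term, evalT. cbn [fst snd].
  set (f := fold_right _ _ _).
  assert (HD : forall w, idom S (evalS X S i w)) by (intro; apply evalS_dom; auto).
  (* The initial word is generalised for the same reason; domain membership is carried along because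
     associativity holds only on the domain. *)
  assert (K : forall r', idom S (fold_right
    (fun p s => imul S (imul S (m (evalS X S i (fst p))) (evalS X S i (snd p))) s)
    (ione S) r') /\ forall u', evA X W S i (mvW S m i) (map inl u' ++ tokens_of_rest r') =
     imul S (evalS X S i u') (fold_right
    (fun p s => imul S (imul S (m (evalS X S i (fst p))) (evalS X S i (snd p))) s)
    (ione S) r')).
  { clear u r f. intro r.
    assert (Hletter : forall a, idom S (letS X S i a))
      by (intros [x|x]; [|apply im_V]; cbn; auto).
    assert (Hcons : forall a u, evalS X S i (a :: u) = imul S (letS X S i a) (evalS X S i u))
      by reflexivity.
    assert (Hnil : evalS X S i [] = ione S) by reflexivity.
    induction r as [|[v u] r [D1 IH]]; cbn [fold_right fst snd].
    - split; [apply im_1; auto|]. induction u' as [|a u' IHu].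
      + rewrite Hnil, im_mul1l; auto using im_1.
      + rewrite Hcons. cbn [map app evA tS]. rewrite IHu, im_mulA; auto using im_1.
    - split; [auto using im_M|]. induction u' as [|a u' IHu].
      + rewrite Hnil, im_mul1l by auto using im_M. cbn [map app evA tS tokens_of_rest flat_map].
        cbn [fst snd]. fold (tokens_of_rest r).
        rewrite IH, im_mulA; auto using im_M.
      + rewrite Hcons. cbn [map app evA tS]. rewrite IHu. symmetry.
        apply im_mulA; auto using im_M. }
  apply K.
Qed.

Lemma closed_F_tclosed S m i : is_inverse_monoid S -> (forall x, idom S (i x)) ->
  (forall v, idom S (m (evalS X S i v))) -> closed_F X G iG S i m = tclosedW S m i.
Proof.
  intros IM Hgen Hm.
  apply functional_extensionality; intro D; apply propositional_extensionality.
  split.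
  - intros H u v. destruct (tokens_of_term_surj u) as [t <-], (tokens_of_term_surj v) as [t' <-].
    rewrite !evA_term by auto. destruct t as [u0 r0], t' as [u1 r1].
    intros Ht g h Hg Hh. unfold tokens_of_term. rewrite !tpath_term. auto.
  - intros H [u0 r0] [u1 r1] Ht g h Hg Hh. rewrite <- !tpath_term.
    apply H; auto. rewrite <- !evA_term in Ht by auto. exact Ht.
Qed.

(** Each of [m s] and [m t] lies in the class whose greatest element is the other. So m depends only
    on the image in [G]. *)
Lemma max_op_ext S m (phi : icar S -> G) s t : is_inverse_monoid S -> is_max_op S m ->
  (forall s t, idom S s -> idom S t -> (phi s = phi t <-> sigma_rel S s t)) ->
  idom S s -> idom S t -> phi s = phi t -> m s = m t.
Proof.
  intros IM Hm Hphi Hs Ht Hst.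
  destruct (Hm s Hs) as (D1 & S1 & M1), (Hm t Ht) as (D2 & S2 & M2).
  apply Hphi in S1, S2; auto.
  apply (nat_le_antisym S IM); auto; [apply M2 | apply M1]; auto; apply Hphi; congruence.
Qed.

(* [m s^-1] and [(m s)^-1] both are the greatest element of the class of [s^-1]. *)
Lemma max_op_inv S m (phi : icar S -> G) s : is_inverse_monoid S -> is_max_op S m ->
  (forall a, idom S a -> phi (iinv S a) = ginv G (phi a)) ->
  (forall s t, idom S s -> idom S t -> (phi s = phi t <-> sigma_rel S s t)) ->
  idom S s -> m (iinv S s) = iinv S (m s).
Proof.
  intros IM Hm HV Hphi Hs.
  destruct (Hm s Hs) as (D1 & S1 & M1).
  assert (Hs' := im_V S IM s Hs).
  destruct (Hm _ Hs') as (D2 & S2 & M2).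
  apply Hphi in S1, S2; auto.
  assert (D3 := im_V S IM _ D2). assert (D4 := im_V S IM _ D1).
  apply (nat_le_antisym S IM); auto.
  - rewrite <- (im_invK S IM (m (iinv S s))) by auto.
    apply nat_le_inv; auto. apply M1; auto. apply Hphi; auto.
    rewrite HV, S2, HV, ginvK; auto.
  - apply M2; auto. apply Hphi; auto. rewrite !HV, S1; auto.
Qed.

Lemma evalS_phi S i (phi : icar S -> G) w : is_inverse_monoid S -> (forall x, idom S (i x)) ->
  (forall a b, idom S a -> idom S b -> phi (imul S a b) = gmul G (phi a) (phi b)) ->
  phi (ione S) = gone G ->
  (forall a, idom S a -> phi (iinv S a) = ginv G (phi a)) ->
  (forall x, phi (i x) = iG x) -> phi (evalS X S i w) = evalG w.
Proof.
  intros IM Hgen h1 h2 h3 h4. induction w as [|a w IH]; [exact h2|].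
  change (phi (imul S (letS X S i a) (evalS X S i w)) = gmul G (lab X G iG a) (evalG w)).
  rewrite h1, IH.
  - f_equal. destruct a; cbn; rewrite ?h3, h4; auto.
  - destruct a; cbn; auto. apply im_V; auto.
  - apply evalS_dom; auto.
Qed.

(** Applying m to an arbitrary element gives nothing beyond m of words of letters, because these
    already realise every sigma-class. *)
Lemma F_object_iff S m i : group_generated X G iG ->
  F_object X G iG S m i <-> is_max_op S m /\ exists phi, objectW S m i phi.
Proof.
  intro HG. split.
  - intros (IM & Hm & (Hgen & Hind) & HGI). split; auto. assert (HGI' := HGI).
    destruct HGI' as (phi & h1 & h2 & h3 & h4 & h5). exists phi.
    assert (HD : forall w, idom S (evalS X S i w)) by (intro; apply evalS_dom; auto).
    assert (Hphi : forall w, phi (evalS X S i w) = evalG w)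
      by (intro; apply evalS_phi; auto).
    assert (HV : valued X W word_inv S i (mvW S m i)).
    { split; auto.
      - intro v. apply Hm; auto.
      - intro v. rewrite evalS_word_inv by auto. apply (max_op_inv S m phi); auto. }
    assert (Hmphi : forall s, idom S s -> phi (m s) = phi s).
    { intros s Hs. destruct (Hm s Hs) as (? & ? & _). apply h5; auto. }
    split; auto.
    + apply (max_op_E_unitary S IM m Hm).
    + intros s Hs.
      (* The predicate includes the domain, since the induction premises of [generated_fim] range
         over the whole carrier. *)
      assert (K : idom S s /\ exists w, evA X W S i (mvW S m i) w = s); [|apply K].
      revert s Hs. apply Hind.
      * intro x. split; auto. exists [inl (inl x)]. apply (evA_one HV).
      * split; [apply im_1; auto|]. exists []. reflexivity.
      * intros a b [Da [u Hu]] [Db [v Hv]]. split; [apply im_M; auto|]. exists (u ++ v).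
        rewrite (evA_app HV). congruence.
      * intros a [Da [u Hu]]. split; [apply im_V; auto|]. exists (winv X W word_inv u).
        rewrite (evA_winv HV). congruence.
      * intros a [Da _]. split; [apply Hm; auto|].
        (* A word [v] with the image of [a] in [G] satisfies [m a = m v], the value of the jump
           [v]. *)
        destruct (evalG_surj HG (phi a)) as [v Hv]. exists [inr v].
        rewrite (evA_one HV). cbn.
        apply (max_op_ext S m phi); auto. congruence.
    + intro v. rewrite Hmphi, Hphi; auto.
    + intros s v Hs Hv. apply Hm; auto. apply h5; auto. congruence.
  - intros [Hm (phi & HO)]. destruct (obj_val HO) as [IM Hgen _ _].
    split; [auto | split; [auto | split; [split; [auto|]|]]].
    + intros P P1 P2 P3 P4 P5 s Hs.
      destruct (obj_surj HO s Hs) as [w <-].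
      assert (HP : forall a, P (letS X S i a)) by (intros [x|x]; cbn; auto).
      apply evA_induction; auto. intros [a|v]; cbn; auto.
      apply P5. induction v as [|a v IH]; [exact P2 | apply P3; auto].
    + exists phi. destruct HO. auto.
Qed.

(** [Sc_m] depends only on the second component, which is the value of some word, so its values are
    those of jumps. The second conclusion lets the general results on [Sc_jump] be read as results
    on [Sc_m]. *)
Lemma Sc_max_op c : group_generated X G iG -> GF_closure X G tconnectedW c ->
  is_max_op (Sc X G tconnectedW c) (Sc_m X G tconnectedW c) /\
  (fun v => Sc_m X G tconnectedW c (evalS X _ (Sc_gen X G iG tconnectedW c) v)) =
    Sc_jump X G iG W evalG c.
Proof.
  intros HG Hc.
  pose proof (Sc_object _ _ _ _ _ _ word_invK evalG_word_inv c Hc) as HO.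
  assert (HE : forall p v, snd p = evalG v ->
    Sc_m X G tconnectedW c p = Sc_jump X G iG W evalG c v).
  { intros p v Hp. unfold Sc_m, Sc_jump. rewrite Hp. reflexivity. }
  pose proof (obj_val HO) as HV.
  split.
  - intros s Hs. destruct (evalG_surj HG (snd s)) as [v Hv].
    rewrite (HE s v) by auto.
    assert (HD := val_mv HV v).
    split; [exact HD | split].
    + apply (obj_phi_sigma HO); auto.
    + intros t Ht Hst. apply (obj_phi_sigma HO) in Hst; auto.
      apply (obj_max HO); auto. congruence.
  - apply functional_extensionality; intro v. apply HE.
    rewrite <- (evA_map_inl X W _ _ (Sc_jump X G iG W evalG c)).
    rewrite (phi_evA HO). apply wG_map_inl.
Qed.

(** Every element [a] shares its image in [G] with a word [v] of letters, and [f] preserves these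
    images. By [max_op_ext], both [mS a] and [mT (f a)] can be computed from [v]. *)
Lemma canon_fim_morph_iff S mS iS phiS T mT iT phiT f : group_generated X G iG ->
  is_max_op S mS -> is_max_op T mT ->
  objectW S mS iS phiS -> objectW T mT iT phiT ->
  canon_fim_morph X S mS iS T mT iT f <->
  canon_im_morph X S iS T iT f /\ forall v, f (mS (evalS X S iS v)) = mT (evalS X T iT v).
Proof.
  intros HG HmS HmT HS HT.
  pose proof (obj_val HS) as VS.
  pose proof (obj_val HT) as VT.
  assert (HSphi := fun w => phi_evA HS w).
  assert (HTphi := fun w => phi_evA HT w).
  assert (DS : forall w, idom S (evalS X S iS w)) by (intro; apply evalS_dom; apply VS).
  assert (DT : forall w, idom T (evalS X T iT w)) by (intro; apply evalS_dom; apply VT).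
  unfold canon_fim_morph. split; intros [Hf Hm]; split; auto.
  - intro v. rewrite Hm by auto. f_equal.
    rewrite <- !(evA_map_inl X Empty_set _ _ (mv0 _)).
    apply (canon_morph_evA X Empty_set id); auto; [apply valued0; apply VS | intros []].
  - intros a Ha. destruct (obj_surj HS a Ha) as [w <-].
    destruct (evalG_surj HG (wG X G iG W evalG w)) as [v Hv].
    rewrite (proj2 (canon_morph_evA _ _ _ _ _ _ _ _ _ f w VS Hf Hm)).
    replace (mS (evA X W S iS (mvW S mS iS) w)) with (mS (evalS X S iS v)).
    + rewrite Hm. apply (max_op_ext T mT phiT); auto; try apply VT.
      * apply HT.
      * apply (evA_dom VT).
      * rewrite HTphi, <- Hv, <- (wG_map_inl X G iG W evalG), <- HTphi, evA_map_inl. auto.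
    + apply (max_op_ext S mS phiS); auto; try apply VS.
      * apply HS.
      * rewrite HSphi, <- Hv, <- (wG_map_inl X G iG W evalG), <- HSphi, evA_map_inl. auto.
Qed.

End Words.

Theorem mainTheorem9 (X : Type) (G : group) (iG : X -> G)
  (HG : group_generated X G iG) :
  (* (1) E(X,G) is equivalent to C(X,G) via S |-> c_S and c |-> S_c *)
  ((forall (S : imdata) (i : X -> icar S),
      E_object X G iG S i ->
      exists c, GF_closure X G (PCSub X G iG) c /\
        represents X G (PCSub X G iG) c (closed_E X G iG S i) /\
        exists f, canon_im_morph X (Sc X G (PCSub X G iG) c)
                    (Sc_gen X G iG (PCSub X G iG) c) S i f /\
                  bijective_on (Sc X G (PCSub X G iG) c) S f) /\
   (forall c, GF_closure X G (PCSub X G iG) c ->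
      E_object X G iG (Sc X G (PCSub X G iG) c)
        (Sc_gen X G iG (PCSub X G iG) c) /\
      represents X G (PCSub X G iG) c
        (closed_E X G iG (Sc X G (PCSub X G iG) c)
           (Sc_gen X G iG (PCSub X G iG) c))) /\
   (forall (S : imdata) (iS : X -> icar S) (T : imdata) (iT : X -> icar T)
           (cS cT : graph X G -> graph X G),
      E_object X G iG S iS -> E_object X G iG T iT ->
      represents X G (PCSub X G iG) cS (closed_E X G iG S iS) ->
      represents X G (PCSub X G iG) cT (closed_E X G iG T iT) ->
      ((exists f, canon_im_morph X S iS T iT f) <->
       (forall D, PCSub X G iG D -> subg X G (cS D) (cT D))))) /\
  (* (2) F(X,G) is equivalent to S(X,G) via S |-> c_S and c |-> S_c *)
  ((forall (S : imdata) (m : icar S -> icar S) (i : X -> icar S),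
      F_object X G iG S m i ->
      exists c, GF_closure X G (PSub X G iG) c /\
        represents X G (PSub X G iG) c (closed_F X G iG S i m) /\
        exists f, canon_fim_morph X (Sc X G (PSub X G iG) c)
                    (Sc_m X G (PSub X G iG) c)
                    (Sc_gen X G iG (PSub X G iG) c) S m i f /\
                  bijective_on (Sc X G (PSub X G iG) c) S f) /\
   (forall c, GF_closure X G (PSub X G iG) c ->
      F_object X G iG (Sc X G (PSub X G iG) c) (Sc_m X G (PSub X G iG) c)
        (Sc_gen X G iG (PSub X G iG) c) /\
      represents X G (PSub X G iG) c
        (closed_F X G iG (Sc X G (PSub X G iG) c)
           (Sc_gen X G iG (PSub X G iG) c) (Sc_m X G (PSub X G iG) c))) /\
   (forall (S : imdata) (mS : icar S -> icar S) (iS : X -> icar S)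
           (T : imdata) (mT : icar T -> icar T) (iT : X -> icar T)
           (cS cT : graph X G -> graph X G),
      F_object X G iG S mS iS -> F_object X G iG T mT iT ->
      represents X G (PSub X G iG) cS (closed_F X G iG S iS mS) ->
      represents X G (PSub X G iG) cT (closed_F X G iG T iT mT) ->
      ((exists f, canon_fim_morph X S mS iS T mT iT f) <->
       (forall D, PSub X G iG D -> subg X G (cS D) (cT D))))).
Proof.
  rewrite (PCSub_tconnected X G iG), (PSub_tconnected X G iG HG).
  split; (split; [|split]).
  - intros S i HE. apply E_object_iff in HE. destruct HE as [phi HO].
    destruct (object_closure_monoid _ _ _ _ _ id (fun _ => eq_refl)
      (fun j : Empty_set => match j with end) _ _ _ _ HO)
      as (c & H1 & H2 & f & H3 & _ & _ & H4).
    exists c. rewrite closed_E_tclosed. eauto.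
  - intros c Hc.
    (* Both sides are functions on the empty type. *)
    assert (Hj : Sc_jump X G iG Empty_set (jG0 G) c = mv0 _)
      by (apply functional_extensionality; intros []).
    split.
    + apply E_object_iff. exists snd. rewrite <- Hj.
      apply Sc_object; auto. intros [].
    + rewrite closed_E_tclosed, <- Hj. apply (Sc_represents _ _ _ _ _ id); auto. intros [].
  - intros S iS T iT cS cT HS HT. apply E_object_iff in HS, HT.
    destruct HS as [phiS HS], HT as [phiT HT].
    rewrite !closed_E_tclosed. intros HcS HcT.
    rewrite <- (object_morph_iff _ _ _ _ _ id (fun _ => eq_refl)
      (fun j : Empty_set => match j with end) _ _ _ _ _ _ _ _ _ _ HS HT HcS HcT).
    split; [intros [f Hf]; exists f; split; [auto | intros []] | intros [f [Hf _]]; eauto].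
  - intros S m i HF. apply (F_object_iff X G iG S m i HG) in HF. destruct HF as [Hm [phi HO]].
    destruct (object_closure_monoid _ _ _ _ _ _ (word_invK X) (evalG_word_inv X G iG)
      _ _ _ _ HO) as (c & H1 & H2 & f & H3 & H4 & H5 & H6).
    pose proof (obj_val HO) as HV.
    exists c. rewrite closed_F_tclosed by (apply HV || apply (val_mv HV)).
    split; [auto | split; [auto|]]. exists f. split; [|auto].
    destruct (Sc_max_op X G iG c HG H1) as [Hm' Hj].
    pose proof (Sc_object _ _ _ _ _ _ (word_invK X) (evalG_word_inv X G iG) c H1) as HO'.
    rewrite <- Hj in HO', H4.
    apply (canon_fim_morph_iff X G iG _ _ _ _ _ _ _ _ f HG Hm' Hm HO' HO).
    split; auto.
  - intros c Hc.
    destruct (Sc_max_op X G iG c HG Hc) as [Hm' Hj].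
    pose proof (Sc_object _ _ _ _ _ _ (word_invK X) (evalG_word_inv X G iG) c Hc) as HO'.
    pose proof (Sc_represents _ _ _ _ _ _ (word_invK X) (evalG_word_inv X G iG) c Hc) as HR.
    rewrite <- Hj in HO', HR. pose proof (obj_val HO') as HV.
    split; [apply (F_object_iff X G iG _ _ _ HG); eauto|].
    rewrite closed_F_tclosed by (apply HV || apply (val_mv HV)). exact HR.
  - intros S mS iS T mT iT cS cT HS HT.
    apply (F_object_iff X G iG _ _ _ HG) in HS, HT.
    destruct HS as [HmS [phiS HS]], HT as [HmT [phiT HT]].
    pose proof (obj_val HS) as VS. pose proof (obj_val HT) as VT.
    rewrite !closed_F_tclosed
      by ((apply VS || apply VT) || (apply (val_mv VS) || apply (val_mv VT))).
    intros HcS HcT.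
    rewrite <- (object_morph_iff _ _ _ _ _ _ (word_invK X) (evalG_word_inv X G iG)
      _ _ _ _ _ _ _ _ _ _ HS HT HcS HcT).
    split; intros [f Hf]; exists f;
      apply (canon_fim_morph_iff X G iG _ _ _ _ _ _ _ _ f HG HmS HmT HS HT); auto.
Qed.
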